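(* Let $q=2^r$ ($r\ge1$) and let $\mathbb{G}_q$ be the Galois ring of characteristic $4$ with $q^2$ elements. Then there exists a projective $\bigl((q^4-q)/2,\,q^2/2\bigr)$-arc in $\mathrm{PHG}(2,\mathbb{G}_q)$ which meets every line in either $0$ or $q^2/2$ points. Moreover $\mathrm{m}_{q^2/2}(\mathbb{G}_q)=(q^4-q)/2$.
   Context: The Galois ring $\mathbb{G}_q$ ($q=2^r$) is $\mathbb{Z}_4[X]/(h)$ with $h\in\mathbb{Z}_4[X]$ monic of degree $r$ and irreducible modulo $2$; it is a chain ring of length $2$ with residue field $\mathbb{F}_q$. The projective Hjelmslev plane $\mathrm{PHG}(2,R)$ is the incidence structure whose points are the free rank-$1$ submodules of the right module $R_R^3$, whose lines are the free rank-$2$ submodules of $R_R^3$, with incidence given by inclusion. A projective $(k,n)$-arc is a set of $k$ points meeting every line in at most $n$ points. For $0\le n\le q^2+q$, $\mathrm{m}_n(R)$ denotes the largest $k$ such that a projective $(k,n)$-arc exists in $\mathrm{PHG}(2,R)$. *)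

(* Defs.v *)
From HB Require Import structures.
From mathcomp Require Import all_boot all_order all_algebra.
Set Implicit Arguments. Unset Strict Implicit. Unset Printing Implicit Defensive.
Import GRing.Theory.
Local Open Scope ring_scope.

Definition red2 (c : 'Z_4) : 'F_2 := (nat_of_ord c)%:R.

(* R is (isomorphic to) the Galois ring G_q = Z_4[X]/(h), q = 2^r:
   h monic of degree r, irreducible mod 2, and f : Z_4[X] -> R a surjective
   ring morphism with kernel (h). *)
Definition is_galois_ring (R : finComNzRingType) (r : nat) : Prop :=
  exists h : {poly 'Z_4},
    [/\ h \is monic, size h = r.+1,
        irreducible_poly (map_poly red2 h) &
        exists f : {rmorphism {poly 'Z_4} -> R},
          (forall y : R, exists p, f p = y) /\
          (forall p, f p = 0 <-> exists g, p = g * h)].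

(* PHG(2,R): points are free rank-1 submodules of R^3, lines free rank-2
   submodules (R commutative, so right = left module). Stated as booleans
   (all quantifiers are over finite types). *)
Definition is_point (R : finComNzRingType) (P : {set 'rV[R]_3}) : bool :=
  [exists x : 'rV[R]_3,
    (P == [set a *: x | a : R]) && [forall a : R, (a *: x == 0) ==> (a == 0)]].

Definition is_line (R : finComNzRingType) (L : {set 'rV[R]_3}) : bool :=
  [exists x : 'rV[R]_3, exists y : 'rV[R]_3,
    (L == [set a *: x + b *: y | a : R, b : R]) &&
    [forall a : R, forall b : R,
       (a *: x + b *: y == 0) ==> ((a == 0) && (b == 0))]].

Definition meet (R : finComNzRingType) (K : {set {set 'rV[R]_3}})
  (L : {set 'rV[R]_3}) : nat := #|[set P in K | P \subset L]|.

Definition is_arc (R : finComNzRingType) (K : {set {set 'rV[R]_3}}) (n : nat)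
  : bool :=
  [forall P in K, is_point P] && [forall L, is_line L ==> (meet K L <= n)%N].

Definition m_arc (R : finComNzRingType) (n : nat) : nat :=
  \max_(K : {set {set 'rV[R]_3}} | is_arc K n) #|K|.

(* Main.v *)
(* Let T* be the group of Teichmueller units of a cubic Galois extension S of
   the Galois ring R, and lam : S -> R a coordinate.  Identifying R^3 with S,
   the points are the units of S modulo those of R, and the lines are the
   kernels of s |-> lam (s u) with u a unit.  The q^2 + q + 1 lines given by
   u in T* form a dual hyperoval: the Teichmueller lift of a sum x + y of
   elements of T* is x + y + 2 sqrt (x y), so three of them through one point
   would yield an element of degree 2 in the residue field of S, which has
   degree 3 over that of R; counting then puts every point on 0 or 2 of these
   lines.  The points on none of them form the arc.

   For the upper bound, let u be the largest number of points of the arc in a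
   neighbour class.  If 2 u <= q (q - 1), sum over the q^2 + q + 1 classes;
   otherwise count along the lines through a point of that class. *)
Require Import Defs.
From HB Require Import structures.
From mathcomp Require Import all_boot all_order all_algebra.
From mathcomp Require Import ring zify.
Set Implicit Arguments. Unset Strict Implicit. Unset Printing Implicit Defensive.
Import GRing.Theory.
Local Open Scope ring_scope.

(** * Chain rings and Teichmueller units *)

(** Incidence [lam (p * u) = 0] is symmetric in p and u, and multiplication by units moves any line
    to any other. So one count on the line [lam s = 0] yields both the intersection of two lines and
    the join of two points. All counts are made on units of S, where each point or line appears q^2
    - q times, and on T*, where each line of the oval appears q - 1 times. Distinct lines meet in q
    points if they are neighbours and in one point otherwise. Oval lines are pairwise not
    neighbours, and every neighbour class of lines contains exactly one of them. On an oval line,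
    which has q^2 + q points, the other q^2 + q oval lines therefore cut out one point each. The
    total degree is 2 (q^2 + q), twice the number of points, so the bound 2 is attained at each of
    them. On any other line, the neighbouring oval line contributes q incidences and the rest q^2 +
    q; this leaves exactly q^2 / 2 points of degree 0. The threshold 2 u = q (q - 1) in the upper
    bound is where its two estimates coincide, both being (q^4 - q) / 2. *)

Lemma card_additive (A B : finZmodType) (f : A -> B) :
  {morph f : x y / x - y} ->
  #|A| = (#|[set x | f x == 0%R]| * #|[set f x | x : A]|)%N.
Proof.
move=> fB; rewrite -cardsT.
rewrite (card_partition (preim_partitionP f setT)).
(* Each fibre is a translate of the kernel. *)
rewrite (eq_bigr (fun=> #|[set x | f x == 0]|)); last first.
  move=> C /imsetP[x _ ->]; rewrite -(card_imset _ (addIr (- x))).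
  apply: eq_card => y; rewrite [in RHS]inE; apply/imsetP/idP => [[z]|yK].
    by rewrite !inE /= => /eqP fz ->; rewrite fB fz subrr.
  exists (y + x); last by rewrite addrK.
  by rewrite !inE /= eq_sym -subr_eq0 -fB addrK.
rewrite big_const iter_addn_0; congr (_ * _)%N.
have -> : preim_partition f setT = [set f @^-1: [set y] | y in [set f x | x : A]].
  apply/setP => C; apply/imsetP/imsetP => [[x _ ->]|[y /imsetP[x _ ->] ->]].
    exists (f x); first exact: imset_f.
    by apply/setP => z; rewrite !inE /= eq_sym.
  by exists x => //; apply/setP => z; rewrite !inE /= eq_sym.
rewrite card_in_imset // => _ _ /imsetP[x _ ->] /imsetP[y _ ->] /setP/(_ x).
by rewrite !inE eqxx => /esym/eqP.
Qed.

(* Chain rings of length 2 with maximal ideal (2) and characteristic 4.  Two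
   elements are congruent modulo 2 exactly when 2 * x = 2 * y, which is how
   congruences are written throughout; the units are the elements of nonnil. *)
Definition chain2 (A : finComNzRingType) : Prop :=
  [/\ 4%:R = 0 :> A,
      forall a : A, 2 * a = 0 -> exists b, a = 2 * b &
      forall a : A, 2 * a <> 0 -> exists b, a * b = 1].

Section ChainRing.
Variable (A : finComNzRingType).
Hypothesis chA : chain2 A.
Implicit Types a b x y z : A.

Definition nonnil : {set A} := [set a | 2 * a != 0].

Lemma chain4 a : 2 * (2 * a) = 0.
Proof. by case: chA => h4 _ _; rewrite mulrA -natrM h4 mul0r. Qed.

Lemma nil_double a : 2 * a = 0 -> exists b, a = 2 * b.
Proof. by case: chA => _ + _; apply. Qed.

Lemma unit_nonnil a : a \in nonnil -> exists b, a * b = 1.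
Proof. by case: chA => _ _ h; rewrite inE => /eqP/h. Qed.

Lemma two_neq0 : (2 : A) <> 0.
Proof.
move=> h; have [b] := nil_double (a := 1) (eq_trans (mulr1 _) h).
by rewrite h mul0r => /eqP; rewrite oner_eq0.
Qed.

Lemma nonnil_unit a b : a * b = 1 -> a \in nonnil.
Proof.
move=> ab; rewrite inE; apply/eqP => h; apply: two_neq0.
by rewrite -(mulr1 (2 : A)) -[X in _ * X]ab mulrA h mul0r.
Qed.

Lemma nonnil1 : 1 \in nonnil.
Proof. by apply: (@nonnil_unit _ 1); rewrite mulr1. Qed.

Lemma nil_mul a b : 2 * (a * b) = 0 -> 2 * a = 0 \/ 2 * b = 0.
Proof.
move=> h; case: (boolP (a \in nonnil)) => [/unit_nonnil[c ac]|]; last first.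
  by rewrite inE negbK => /eqP; left.
by right; have -> : 2 * b = c * (2 * (a * b)) - 2 * b * (a * c - 1);
  [ring | rewrite h ac; ring].
Qed.

Lemma nonnilM a b : (a * b \in nonnil) = (a \in nonnil) && (b \in nonnil).
Proof.
rewrite !inE; apply/idP/andP => [h|[ha hb]].
  split; apply: contraNneq h => h; first by rewrite mulrA h mul0r.
  by rewrite mulrCA h mulr0.
by apply/eqP => /nil_mul[] /eqP; apply/negP.
Qed.

Lemma unit_cancel a x y : a \in nonnil -> a * x = a * y -> x = y.
Proof.
move=> /unit_nonnil[b ab] h; rewrite -[x]mul1r -[y]mul1r -ab.
by rewrite ![a * b]mulrC -!mulrA h.
Qed.

(** The error term of a congruence modulo 2 contributes only multiples of 4 to the square. One
    squaring thus makes congruent elements equal, so that [a ^+ Q] depends only on [a] modulo 2. *)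
Lemma eqm_sqr x y : 2 * x = 2 * y -> x ^+ 2 = y ^+ 2.
Proof.
move=> h; have [w hw] : exists w, x - y = 2 * w.
  by apply: nil_double; rewrite mulrBr h subrr.
have -> : x = y + 2 * w by rewrite -hw; ring.
have -> : (y + 2 * w) ^+ 2 = y ^+ 2 + 2 * (2 * (y * w + w * w)) by ring.
by rewrite chain4 addr0.
Qed.

Lemma eqm_expn x y n : (0 < n)%N -> 2 * x = 2 * y -> x ^+ (2 ^ n) = y ^+ (2 ^ n).
Proof. by case: n => // n _ /eqm_sqr h; rewrite expnS !exprM h. Qed.

Lemma eqm_sqr_inj x y : 2 * x ^+ 2 = 2 * y ^+ 2 -> 2 * x = 2 * y.
Proof.
move=> h; apply/eqP; rewrite -subr_eq0 -mulrBr; apply/eqP.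
suff /nil_mul[] : 2 * ((x - y) * (x - y)) = 0 by [].
have -> : 2 * ((x - y) * (x - y)) = 2 * x ^+ 2 - 2 * y ^+ 2 + 2 * (2 * (y ^+ 2 - x * y)).
  by ring.
by rewrite h chain4 subrr addr0.
Qed.

Lemma eqm_expn_inj x y n : 2 * x ^+ (2 ^ n) = 2 * y ^+ (2 ^ n) -> 2 * x = 2 * y.
Proof.
elim: n => [|n IHn]; first by rewrite !expr1.
by rewrite expnSr !exprM => /eqm_sqr_inj.
Qed.

Variable Q : nat.
Hypothesis cardA : #|A| = (Q ^ 2)%N.

(** Multiplication by 2 has its image equal to its kernel, so the order of [A] is the square of the
    order of that kernel. *)
Lemma card_nil : #|[set a : A | 2 * a == 0]| = Q.
Proof.
have fB : {morph (fun a : A => 2 * a) : x y / x - y} by move=> x y; rewrite mulrBr.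
have := card_additive fB; rewrite cardA.
have -> : [set 2 * x | x : A] = [set a | 2 * a == 0].
  apply/setP => a; rewrite inE; apply/imsetP/eqP => [[b _ ->]|/nil_double[b ->]].
    exact: chain4.
  by exists b.
by rewrite mulnn => /eqP; rewrite eqn_exp2r // => /eqP.
Qed.

Lemma card_nonnil : #|nonnil| = (Q ^ 2 - Q)%N.
Proof.
rewrite -cardA -card_nil -cardsT -cardsDS ?subsetT //; apply: eq_card => a.
by rewrite !inE andbT.
Qed.

(** Lagrange's theorem for the units: multiplication by [a] permutes them and so preserves their
    product. *)
Lemma nonnil_exp_card a : a \in nonnil -> a ^+ (Q ^ 2 - Q) = 1.
Proof.
move=> aU; rewrite -card_nonnil.
have prodU : \prod_(x in nonnil) x \in nonnil.
  by elim/big_ind: _ => [|x y hx hy|//]; rewrite ?nonnil1 // nonnilM hx.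
apply: (unit_cancel prodU); rewrite mulr1 mulrC -prodr_const -big_split /=.
have [b ab] := unit_nonnil aU.
rewrite [RHS](reindex_onto (fun x => a * x) (fun x => b * x)) /=; last first.
  by move=> x _; rewrite mulrA ab mul1r.
apply: eq_bigl => x; rewrite nonnilM aU /=.
by rewrite mulrA [b * a]mulrC ab mul1r eqxx andbT.
Qed.

Variable e : nat.
Hypothesis e_gt0 : (0 < e)%N.
Hypothesis QE : Q = (2 ^ e)%N.

(** Fermat's identity in the residue field. The units number Q (Q - 1), and the Q-th power can be
    cancelled because it iterates the Frobenius map, which is injective modulo 2. *)
Lemma eqm_exp_card a : 2 * a ^+ Q = 2 * a.
Proof.
case: (boolP (a \in nonnil)) => [aU|].
  have h : 2 * a ^+ (Q - 1) = 2 * 1.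
    apply: (@eqm_expn_inj _ _ e); rewrite -QE expr1n -exprM mulnBl mul1n mulnn.
    by rewrite nonnil_exp_card.
  have -> : Q = (Q - 1).+1 by rewrite subn1 prednK // QE expn_gt0.
  by rewrite exprS mulrCA h mulrCA mulr1.
rewrite inE negbK => /eqP h; rewrite h -(subnK (_ : 0 < Q)%N) ?QE ?expn_gt0 //.
by rewrite addn1 exprS mulrA h mul0r.
Qed.

Definition teich : {set A} := [set t in nonnil | t ^+ Q == t].

Lemma teichP t : reflect (t \in nonnil /\ t ^+ Q = t) (t \in teich).
Proof. by apply: (iffP setIdP) => -[h /eqP]. Qed.

Lemma teich_lift a : a \in nonnil -> a ^+ Q \in teich.
Proof.
move=> aU; apply/teichP; split; first by move: aU; rewrite !inE eqm_exp_card.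
by have := eqm_expn e_gt0 (eqm_exp_card a); rewrite -QE.
Qed.

Lemma teich_inj t u : t \in teich -> u \in teich -> 2 * t = 2 * u -> t = u.
Proof.
move=> /teichP[_ ht] /teichP[_ hu] h; rewrite -ht -hu QE.
exact: eqm_expn.
Qed.

Lemma teichM t u : t \in teich -> u \in teich -> t * u \in teich.
Proof.
move=> /teichP[tU ht] /teichP[uU hu]; apply/teichP.
by rewrite nonnilM tU uU exprMn ht hu.
Qed.

Lemma teich_inv t u : t \in teich -> t * u = 1 -> u \in teich.
Proof.
move=> /teichP[tU ht] tu; have uU : u \in nonnil by apply: (@nonnil_unit _ t); rewrite mulrC.
apply/teichP; split => //; apply: (unit_cancel tU).
by rewrite tu -{1}ht -exprMn tu expr1n.
Qed.

(** Squaring [e] times fixes [t], so squaring [e - 1] times produces a square root. *)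
Lemma teich_sqrt t : t \in teich -> exists2 u, u \in teich & u ^+ 2 = t.
Proof.
move=> /teichP[tU ht]; exists (t ^+ (2 ^ e.-1)); last first.
  by rewrite -exprM -expnSr prednK // -QE.
apply/teichP; split; last by rewrite exprAC ht.
by elim: (2 ^ e.-1)%N => [|n IHn]; rewrite ?nonnil1 // exprS nonnilM tU.
Qed.

(** Doubling identifies the Teichmueller units with the nonzero multiples of 2. *)
Lemma card_teich : #|teich| = (Q - 1)%N.
Proof.
have <- : #|[set 2 * t | t in teich]| = #|teich|.
  by apply: card_in_imset => t u; apply: teich_inj.
rewrite -card_nil (cardsD1 0 [set a | _]) inE mulr0 eqxx add1n subn1.
apply: eq_card => a; rewrite !inE; apply/imsetP/andP => [[t]|[a0 /eqP/nil_double[b ab]]].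
  by rewrite 2!inE => /andP[tU _] ->; rewrite chain4.
exists (b ^+ Q); last by rewrite eqm_exp_card.
by apply: teich_lift; rewrite inE -ab.
Qed.

(* If x = u^2 and y = v^2 then (u + v)^2 is the Teichmueller lift of x + y. *)
Lemma teich_add x y z : x \in teich -> y \in teich -> z \in teich ->
  2 * z = 2 * (x + y) ->
  exists2 w, z = x + y + 2 * w & 2 * w ^+ 2 = 2 * (x * y).
Proof.
move=> /teich_sqrt[u _ <-] /teich_sqrt[v _ <-] /teich_sqrt[w _ <-] h.
exists (u * v); last by rewrite exprMn.
have /eqm_sqr -> : 2 * w = 2 * (u + v); last by ring.
apply: eqm_sqr_inj; rewrite h.
have -> : 2 * (u + v) ^+ 2 = 2 * (u ^+ 2 + v ^+ 2) + 2 * (2 * (u * v)) by ring.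
by rewrite chain4 addr0.
Qed.

End ChainRing.
Arguments teichP {A Q t}.

(** * The cubic extension *)

Lemma card_set_sum (T : finType) (P : pred T) :
  #|[set x | P x]| = (\sum_x P x)%N.
Proof.
rewrite -sum1_card big_mkcond /=; apply: eq_bigr => x _.
by rewrite inE; case: (P x).
Qed.

Section RootlessCubic.
Variable (R : finComNzRingType) (q : nat).
Hypothesis chR : chain2 R.
Hypothesis cardR : #|R| = (q ^ 2)%N.

Lemma card_nil_translate (k : R) : #|[set x | 2 * (k - x) == 0]| = q.
Proof.
rewrite -(card_nil chR cardR) -(card_imset _ (subrI k)); apply: eq_card => x.
rewrite [LHS]inE; apply/idP/imsetP => [xN|[y]]; last by rewrite inE => h ->; rewrite subKr.
by exists (k - x); [rewrite inE | rewrite subKr].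
Qed.

(* Double counting of pairs (cubic, root mod 2): each cubic would have at least
   q roots, and X^3 - X^2 has at least 2q. *)
Lemma rootless_cubic :
  exists a b c : R, forall x, 2 * (x ^+ 3 - a * x ^+ 2 - b * x - c) <> 0.
Proof.
pose root (p : R * R * R) x := 2 * (x ^+ 3 - p.1.1 * x ^+ 2 - p.1.2 * x - p.2) == 0.
case: (boolP [exists p, [forall x, ~~ root p x]]).
  by case/existsP=> -[[a b] c] /forallP h; exists a, b, c => x /eqP; apply/negP/h.
rewrite negb_exists => /forallP allroot; exfalso.
have q_gt0 : (0 < q)%N.
  rewrite -(card_nil chR cardR); apply/card_gt0P; exists 0.
  by rewrite inE mulr0.
have rootsub p x y : root p x -> 2 * (x - y) == 0 -> root p y.
  rewrite /root => /eqP hx /eqP hxy; apply/eqP.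
  pose w := x ^+ 2 + x * y + y ^+ 2 - p.1.1 * (x + y) - p.1.2.
  have -> : 2 * (y ^+ 3 - p.1.1 * y ^+ 2 - p.1.2 * y - p.2) =
    2 * (x ^+ 3 - p.1.1 * x ^+ 2 - p.1.2 * x - p.2) - 2 * (x - y) * w.
    by rewrite /w; ring.
  by rewrite hx hxy mul0r subr0.
have roots_ge p : (q <= #|[set x | root p x]|)%N.
  have := allroot p; rewrite negb_forall => /existsP[x]; rewrite negbK => hx.
  rewrite -(card_nil_translate x); apply/subset_leq_card/subsetP => y.
  by rewrite !inE; apply: rootsub.
pose p0 : R * R * R := (1, 0, 0).
have roots_p0 : (q + q <= #|[set x | root p0 x]|)%N.
  rewrite -{1}(card_nil_translate 0) -(card_nil_translate 1).
  rewrite -cardsUI [X in (_ + X)%N](_ : _ = 0%N) ?addn0; last first.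
    apply/eqP; rewrite cards_eq0; apply/eqP.
    apply/setP => x; rewrite !inE; apply/negP => /andP[/eqP h0 /eqP h1].
    apply: (two_neq0 chR); have -> : 2 = 2 * (1 - x) - 2 * (0 - x) by ring.
    by rewrite h0 h1 subr0.
  apply/subset_leq_card/subsetP => y; rewrite !inE => /orP[] hy.
    by apply: (rootsub _ _ _ _ hy); rewrite /root /=; apply/eqP; ring.
  by apply: (rootsub _ _ _ _ hy); rewrite /root /=; apply/eqP; ring.
(* Given x, a and b, the coefficient c is determined modulo 2. Hence a cubic has q roots on average,
   which is impossible if none has fewer and one has more. *)
have total : (\sum_p #|[set x | root p x]| = q ^ 7)%N.
  transitivity (\sum_p \sum_(x : R) root p x)%N.
    by apply: eq_bigr => p _; rewrite card_set_sum.
  rewrite exchange_big /=.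
  rewrite (eq_bigr (fun=> (q ^ 5)%N)).
    by rewrite sum_nat_const cardR -expnD.
  move=> x _.
  transitivity (\sum_(ab : R * R) \sum_(c : R) root (ab, c) x)%N.
    by rewrite pair_big; apply: eq_bigr => -[].
  rewrite (eq_bigr (fun=> q)).
    by rewrite sum_nat_const card_prod !cardR -expnD -expnSr.
  move=> [a b] _; rewrite -(card_nil_translate (x ^+ 3 - a * x ^+ 2 - b * x)).
  by rewrite card_set_sum.
have : (\sum_(p : R * R * R) q < \sum_p #|[set x | root p x]|)%N.
  rewrite (bigD1 p0) //= [X in (_ < X)%N](bigD1 p0) //=.
  rewrite -addSn leq_add ?leq_sum //.
  by apply: leq_trans roots_p0; rewrite -addn1 leq_add2l.
by rewrite total sum_nat_const !card_prod !cardR -!expnD -expnSr ltnn.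
Qed.

End RootlessCubic.

(* R[X] / (X^3 - a X^2 - b X - c), with (x0, x1, x2) standing for
   x0 + x1 X + x2 X^2. *)
Definition cubic_ext (R : finComNzRingType) (a b c : R) : Type := (R * R * R)%type.

Section CubicExt.
Variables (R : finComNzRingType) (a b c : R).
Notation S := (cubic_ext a b c).

HB.instance Definition _ := GRing.Zmodule.copy S (R * R * R)%type.
HB.instance Definition _ := Finite.copy S (R * R * R)%type.

Definition cubic_mul (x y : S) : S :=
  let: (x0, x1, x2) := x in let: (y0, y1, y2) := y in
  let p3 := x1 * y2 + x2 * y1 in let p4 := x2 * y2 in
  (x0 * y0 + c * p3 + a * c * p4,
   x0 * y1 + x1 * y0 + b * p3 + (a * b + c) * p4,
   x0 * y2 + x1 * y1 + x2 * y0 + a * p3 + (a ^+ 2 + b) * p4).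

Definition cubic_one : S := (1, 0, 0).

Fact cubic_mulA : associative cubic_mul.
Proof. by move=> [[x0 x1] x2] [[y0 y1] y2] [[z0 z1] z2]; congr (_, _, _); ring. Qed.

Fact cubic_mulC : commutative cubic_mul.
Proof. by move=> [[x0 x1] x2] [[y0 y1] y2]; congr (_, _, _); ring. Qed.

Fact cubic_mul1 : left_id cubic_one cubic_mul.
Proof. by move=> [[x0 x1] x2]; congr (_, _, _); ring. Qed.

Fact cubic_mulDl : left_distributive cubic_mul +%R.
Proof. by move=> [[x0 x1] x2] [[y0 y1] y2] [[z0 z1] z2]; congr (_, _, _); rewrite /=; ring. Qed.

Fact cubic_one_neq0 : cubic_one != 0.
Proof. by apply/eqP => -[] /eqP; rewrite oner_eq0. Qed.

HB.instance Definition _ := GRing.Zmodule_isComNzRing.Build S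
  cubic_mulA cubic_mulC cubic_mul1 cubic_mulDl cubic_one_neq0.

End CubicExt.

Section CubicRing.
Variables (R : finComNzRingType) (a b c : R).
Notation S := (cubic_ext a b c).
Implicit Types (x y : R) (s t : S).

Definition emb (x : R) : S := (x, 0, 0).
Definition lam (s : S) : R := s.2.

Fact emb_is_zmod_morphism : zmod_morphism emb.
Proof. by move=> x y; congr (_, _, _); rewrite /= subr0. Qed.
HB.instance Definition _ := GRing.isZmodMorphism.Build R S emb emb_is_zmod_morphism.

Fact emb_is_monoid_morphism : monoid_morphism emb.
Proof. by split=> // x y; congr (_, _, _); rewrite /=; ring. Qed.
HB.instance Definition _ := GRing.isMonoidMorphism.Build R S emb emb_is_monoid_morphism.

Fact lam_is_zmod_morphism : zmod_morphism lam.
Proof. by []. Qed.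
HB.instance Definition _ := GRing.isZmodMorphism.Build S R lam lam_is_zmod_morphism.

Lemma emb_inj : injective emb.
Proof. by move=> x y []. Qed.

Lemma emb_mul x s : emb x * s = (x * s.1.1, x * s.1.2, x * s.2) :> S.
Proof. by case: s => -[s0 s1] s2; congr (_, _, _); rewrite /=; ring. Qed.

Lemma lam_emb x s : lam (emb x * s) = x * lam s.
Proof. by rewrite emb_mul. Qed.

(** The kernel of [lam] is spanned by 1 and X. On it, passing through a second line becomes a single
    linear equation in the two coordinates, with these coefficients. *)
Lemma lam_linear_mul x y s :
  lam (((x, y, 0) : S) * s) = x * s.2 + y * (s.1.2 + a * s.2).
Proof.
case: s => -[s0 s1] s2.
transitivity (x * s2 + y * s1 + 0 * s0 + a * (y * s2 + 0 * s1) + (a ^+ 2 + b) * (0 * s2)).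
  by [].
by rewrite /=; ring.
Qed.

Lemma cubic_double s : 2 * s = (2 * s.1.1, 2 * s.1.2, 2 * s.2) :> S.
Proof. by rewrite -(rmorph_nat emb 2) emb_mul. Qed.

Lemma cubic_nilP s :
  2 * s = 0 <-> [/\ 2 * s.1.1 = 0, 2 * s.1.2 = 0 & 2 * s.2 = 0].
Proof. by rewrite cubic_double; split=> [[-> -> ->]|[-> -> ->]]. Qed.

Hypothesis chR : chain2 R.

Lemma cubic4 s : 2 * (2 * s) = 0.
Proof. by rewrite !cubic_double /= !chain4. Qed.

Lemma cubic_nil_double s : 2 * s = 0 -> exists t, s = 2 * t.
Proof.
case: s => -[s0 s1] s2 /cubic_nilP[/= /(nil_double chR)[t0 ->]].
move=> /(nil_double chR)[t1 ->] /(nil_double chR)[t2 ->].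
by exists (t0, t1, t2); rewrite cubic_double.
Qed.

Hypothesis rootless : forall x, 2 * (x ^+ 3 - a * x ^+ 2 - b * x - c) <> 0.

Let invertible s := exists t, s * t = 1.

Let invertible_factor s t : invertible (s * t) -> invertible s.
Proof. by case=> w h; exists (t * w); rewrite mulrA. Qed.

Let invertible_emb x : x \in nonnil R -> invertible (emb x).
Proof. by move=> /(unit_nonnil chR)[y xy]; exists (emb y); rewrite -rmorphM xy rmorph1. Qed.

Let invertible_add2 s t : invertible s -> invertible (s + 2 * t).
Proof.
case=> w sw; exists ((s + 2 * t) * w ^+ 2).
have -> : (s + 2 * t) * ((s + 2 * t) * w ^+ 2) =
  (s * w) ^+ 2 + 2 * (2 * ((s * t + t ^+ 2) * w ^+ 2)) by ring.
by rewrite sw expr1n cubic4 addr0.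
Qed.

Let invertible_linear x y : (x \in nonnil R) || (y \in nonnil R) ->
  invertible (x, y, 0).
Proof.
case: (boolP (y \in nonnil R)) => [/(unit_nonnil chR)[z yz] _|]; last first.
  rewrite inE negbK => /eqP/(nil_double chR)[w ->]; rewrite orbF => /invertible_emb h.
  have -> : (x, 2 * w, 0) = emb x + 2 * ((0, w, 0) : S).
    by rewrite cubic_double; congr (_, _, _); rewrite /=; ring.
  exact: invertible_add2.
apply: (@invertible_factor _ (emb z)); rewrite mulrC emb_mul /= mulr0 [z * y]mulrC yz.
pose u := - (z * x).
(* With f the defining cubic, this is the quotient of f(X) - f(u) by X - u. Since f(X) = 0 in S, the
   product with X - u is - f(u), a unit as f has no root modulo 2. *)
apply: (@invertible_factor _ (u ^+ 2 - a * u - b, u - a, 1)).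
rewrite [_ * _](_ : _ = emb (- (u ^+ 3 - a * u ^+ 2 - b * u - c))); last first.
  by congr (_, _, _); rewrite /u; ring.
by apply: invertible_emb; rewrite inE mulrN oppr_eq0; apply/eqP/rootless.
Qed.

Lemma cubic_unit s : 2 * s <> 0 -> exists t, s * t = 1.
Proof.
case: s => -[s0 s1] s2 nz; rewrite -/(invertible _).
case: (boolP (s2 \in nonnil R)) => [/(unit_nonnil chR)[z zs2]|]; last first.
  rewrite inE negbK => /eqP s2N; have [w sE] := nil_double chR s2N.
  have -> : (s0, s1, s2) = (s0, s1, 0) + 2 * ((0, 0, w) : S) :> S.
    by rewrite cubic_double sE; congr (_, _, _); rewrite /=; ring.
  apply/invertible_add2/invertible_linear; rewrite !inE -negb_and.
  by apply/negP => /andP[/eqP h0 /eqP h1]; apply: nz; apply/cubic_nilP.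
apply: (@invertible_factor _ (emb z)); rewrite mulrC emb_mul /= [z * s2]mulrC zs2.
(* The value of w cancels the X^2 term in (X + w) (X^2 + u X + v), reducing to the linear case. If
   the linear remainder vanished modulo 2, X + w would divide the cubic and - w would be a root. *)
set v := z * s0; set u := z * s1; pose w := - (a + u).
apply: (@invertible_factor _ (w, 1, 0)).
rewrite [_ * _](_ : _ = (c + v * w, b + v + u * w, 0)); last first.
  by congr (_, _, _); rewrite /w; ring.
apply: invertible_linear; rewrite !inE -negb_and; apply/negP => /andP[/eqP h0 /eqP h1].
apply: (rootless (x := - w)).
rewrite [LHS](_ : _ = 2 * (b + v + u * w) * w - 2 * (c + v * w)); last first.
  by rewrite /w; ring.
by rewrite h0 h1 mul0r subr0.
Qed.

Lemma cubic_chain2 : chain2 S.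
Proof.
split; [|exact: cubic_nil_double|exact: cubic_unit].
by have := cubic4 1; rewrite mulr1 -natrM.
Qed.

Lemma card_cubic q : #|R| = (q ^ 2)%N -> #|{: S}| = ((q ^ 3) ^ 2)%N.
Proof. by move=> h; rewrite !card_prod h -!expnD -expnM. Qed.

Lemma emb_nonnil x : (emb x \in nonnil S) = (x \in nonnil R).
Proof. by rewrite !inE -(rmorph_nat emb 2) -rmorphM -(inj_eq emb_inj) rmorph0. Qed.

Definition in_base s : bool := (s.1.2 == 0) && (s.2 == 0).

(* Membership in R + 2 S. *)
Definition near_base s : bool := (2 * s.1.2 == 0) && (2 * s.2 == 0).

Lemma in_baseP s : reflect (exists x, s = emb x) (in_base s).
Proof.
apply: (iffP andP) => [[/eqP h1 /eqP h2]|[x ->]]; last by rewrite /= !eqxx.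
by exists s.1.1; case: s h1 h2 => -[s0 s1] s2 /= -> ->.
Qed.

Lemma near_baseP s : reflect (exists x, 2 * s = 2 * emb x) (near_base s).
Proof.
apply: (iffP andP) => [[/eqP h1 /eqP h2]|[x]].
  by exists s.1.1; rewrite !cubic_double h1 h2 /= mulr0.
by rewrite !cubic_double /= mulr0 => -[_ -> ->]; rewrite eqxx.
Qed.

End CubicRing.

(** * The dual hyperoval and its complement *)

Lemma expn4_sub_expn2 q : (q ^ 4 - q ^ 2 = q ^ 2 * (q + 1) * (q - 1))%N.
Proof. by case: q => // d; rewrite subn1 /=; lia. Qed.
Lemma expn3_sub_expn2 q : (q ^ 3 - q ^ 2 = q ^ 2 * (q - 1))%N.
Proof. by case: q => // d; rewrite subn1 /=; lia. Qed.
Lemma expn2_sub q : (q ^ 2 - q = q * (q - 1))%N.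
Proof. by case: q => // d; rewrite subn1 /=; lia. Qed.
Lemma expn3_sub q : (q ^ 3 - q = q * (q + 1) * (q - 1))%N.
Proof. by case: q => // d; rewrite subn1 /=; lia. Qed.
Lemma expn3_sub1 q : (q ^ 3 - 1 = (q ^ 2 + q + 1) * (q - 1))%N.
Proof. by case: q => // d; rewrite subn1 /=; lia. Qed.

(** [N] and [k] count the units in the arc and in one neighbour class, with [D] units to a point.
    With K = N / D and u = k / D, the last hypothesis divided by D^2 reads (q^2 + q) + (u - 1) q +
    (K - u) <= (q^2 + q) n, that is 2 K <= q^4 + q^3 - 2 q^2 - 2 u (q - 1). Inserting 2 u >= q (q -
    1) leaves q^4 - q. *)
Lemma arc_arith q D k N n : (1 < q)%N -> D = (q ^ 2 - q)%N -> (2 * n = q ^ 2)%N ->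
  (q * (q - 1) * D <= 2 * k)%N -> (D <= k <= N)%N ->
  (D * (q ^ 4 - q ^ 2) + (k - D) * (q ^ 3 - q ^ 2) + (N - k) * D
   <= (q ^ 4 - q ^ 2) * (n * D))%N ->
  (2 * N <= (q ^ 4 - q) * D)%N.
Proof.
case: q => [|d] //; rewrite expn4_sub_expn2 expn3_sub_expn2 expn2_sub subSS subn0 ltnS => d0 DE nE kD /andP[Dk kN].
have D0 : (0 < D)%N by rewrite DE muln_gt0.
have [k' kE] : exists k', k = (D + k')%N by exists (k - D)%N; rewrite subnKC.
have [N' NE] : exists N', N = (k + N')%N by exists (N - k)%N; rewrite subnKC.
rewrite {kN Dk}NE {}kE in kD *; rewrite !addKn.
have -> : (d.+1 ^ 2 * (d.+1 + 1) * d = d.+1 * (d.+1 + 1) * D)%N by rewrite DE; lia.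
have -> : (d.+1 ^ 2 * d = d.+1 * D)%N by rewrite DE; lia.
have -> : (D * (d.+1 * (d.+1 + 1) * D) + k' * (d.+1 * D) + N' * D =
  (D * (d.+1 * (d.+1 + 1)) + k' * d.+1 + N') * D)%N by lia.
have -> : (d.+1 * (d.+1 + 1) * D * (n * D) = d.+1 * (d.+1 + 1) * n * D * D)%N by lia.
rewrite leq_pmul2r // -(leq_pmul2l (isT : 0 < 2)%N).
have -> : (2 * (d.+1 * (d.+1 + 1) * n * D) = d.+1 * (d.+1 + 1) * (2 * n) * D)%N by lia.
rewrite nE => h.
have kd : (d * (d.+1 * d * D) <= d * (2 * (D + k')))%N by rewrite leq_mul2l kD orbT.
have -> : (d.+1 ^ 4 - d.+1 = d.+1 ^ 4 - d.+1 ^ 1)%N by [].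
rewrite mulnBl leq_subRL; first by lia.
by rewrite leq_mul2r leq_exp2l ?orbT.
Qed.

Lemma card_setId_sum (U : finType) (A : {set U}) (P : pred U) :
  #|[set x in A | P x]| = (\sum_(x in A) P x)%N.
Proof.
rewrite card_set_sum [RHS]big_mkcond /=; apply: eq_bigr => x _.
by case: (x \in A).
Qed.

(** * Solutions of a linear equation in two unknowns *)

HB.instance Definition _ (U V : finZmodType) := Finite.on (U * V)%type.

Section PairCount.
Variables (R : finComNzRingType) (q : nat).
Hypothesis chR : chain2 R.
Hypothesis cardR : #|R| = (q ^ 2)%N.
Implicit Types m n : R.

(** Coordinates, in the basis 1, X, of the units common to two lines. The three sizes found below,
    divided by q^2 - q, are the numbers q^2 + q, q and 1 of common points of lines that are equal,
    neighbours, or neither. *)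
Definition annih m n : {set R * R} :=
  [set p | ((p.1 \in nonnil R) || (p.2 \in nonnil R)) && (p.1 * m + p.2 * n == 0)].

Let nilpairs : {set R * R} := [set p | (2 * p.1 == 0) && (2 * p.2 == 0)].

Let card_nilpairs : #|nilpairs| = (q ^ 2)%N.
Proof.
rewrite -mulnn -[in RHS](card_nil chR cardR) -cardsX; apply: eq_card => p.
by rewrite !inE.
Qed.

Lemma card_annih0 : #|annih 0 0| = (q ^ 4 - q ^ 2)%N.
Proof.
have -> : (q ^ 4)%N = #|[set: R * R]| by rewrite cardsT card_prod !cardR -expnD.
rewrite -card_nilpairs -cardsDS ?subsetT //; apply: eq_card => p.
by rewrite !inE !mulr0 addr0 eqxx !andbT negb_and.
Qed.

(** The equation is the kernel of a map of R^2 onto 2 R, so it has q^4 / q solutions; all q^2 pairs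
    of non-units are among them and are removed. *)
Lemma card_annih_nil m n : (m \in nonnil R) || (n \in nonnil R) ->
  #|annih (2 * m) (2 * n)| = (q ^ 3 - q ^ 2)%N.
Proof.
move=> mn; pose f (p : R * R) := 2 * (p.1 * m + p.2 * n).
have fB : {morph f : p p' / p - p'} by move=> p p'; rewrite /f /=; ring.
have imf : [set f p | p : R * R] = [set x | 2 * x == 0].
  apply/setP => x; rewrite inE; apply/imsetP/eqP => [[p _ ->]|]; first exact: chain4.
  move=> /(nil_double chR)[y ->]; case/orP: mn => /(unit_nonnil chR)[k hk].
    by exists (y * k, 0) => //; rewrite /f /= mul0r addr0 -mulrA [k * m]mulrC hk mulr1.
  by exists (0, y * k) => //; rewrite /f /= mul0r add0r -mulrA [k * n]mulrC hk mulr1.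
have cardK : #|[set p | f p == 0]| = (q ^ 3)%N.
  have := card_additive fB; rewrite imf (card_nil chR cardR) card_prod !cardR -expnD.
  rewrite (expnSr q 3) => /eqP; rewrite eqn_pmul2r => [/eqP/esym //|].
  by rewrite -(card_nil chR cardR); apply/card_gt0P; exists 0; rewrite inE mulr0.
rewrite -cardK -card_nilpairs -cardsDS.
  apply: eq_card => p; rewrite !inE negb_and; congr (_ && _); congr (_ == _).
  by rewrite /f; ring.
apply/subsetP => p; rewrite !inE /f => /andP[/eqP h1 /eqP h2].
by rewrite mulrDr !mulrA h1 h2 !mul0r addr0.
Qed.

Let annihC m n : #|annih m n| = #|annih n m|.
Proof.
have inj : injective (fun p : R * R => (p.2, p.1)) by move=> [? ?] [? ?] [-> ->].
rewrite -(card_imset _ inj); apply: eq_card => p.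
apply/imsetP/idP => [[p' h ->]|h].
  by move: h; rewrite !inE /= orbC addrC.
exists (p.2, p.1); last by case: p h.
by move: h; rewrite !inE /= orbC addrC.
Qed.

Let card_annih_l m n : m \in nonnil R -> #|annih m n| = (q ^ 2 - q)%N.
Proof.
move=> mU; have [k mk] := unit_nonnil chR mU.
rewrite -(card_nonnil chR cardR).
have inj : injective (fun y => (- (k * n * y), y)) by move=> x y [].
rewrite -(card_imset _ inj); apply: eq_card => -[x y].
have xE x' y' : (x' * m + y' * n == 0) = (x' == - (k * n * y')).
  apply/eqP/eqP => [h|->].
    have -> : x' = k * (x' * m + y' * n) - x' * (m * k - 1) - k * n * y' by ring.
    by rewrite h mk subrr; ring.
  have -> : - (k * n * y') * m + y' * n = - y' * n * (m * k - 1) by ring.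
  by rewrite mk subrr mulr0.
apply/idP/imsetP => [|[z zU [-> ->]]].
  rewrite inE /= xE => /andP[h /eqP xy]; exists y; last by rewrite -xy.
  by move: h; rewrite xy -mulNr nonnilM //; case: (y \in _); rewrite ?andbF.
by rewrite inE /= xE eqxx zU orbT.
Qed.

Lemma card_annih_unit m n : (m \in nonnil R) || (n \in nonnil R) ->
  #|annih m n| = (q ^ 2 - q)%N.
Proof. by case/orP=> h; [|rewrite annihC]; apply: card_annih_l. Qed.

End PairCount.

(** * Incidence counts for the dual hyperoval *)

Section Hyperoval.
Variables (R : finComNzRingType) (a b c : R) (q r : nat).
Notation S := (cubic_ext a b c).
Notation emb := (@emb R a b c).
Notation Q := (q ^ 3)%N.
Hypothesis chR : chain2 R.
Hypothesis cardR : #|R| = (q ^ 2)%N.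
Hypothesis rootless : forall x : R, 2 * (x ^+ 3 - a * x ^+ 2 - b * x - c) <> 0.
Hypothesis r_gt0 : (0 < r)%N.
Hypothesis qE : q = (2 ^ r)%N.
Implicit Types (x y : R) (p s t u v w : S).

Let chS : chain2 S := cubic_chain2 chR rootless.
Let cardS : #|{: S}| = (Q ^ 2)%N := card_cubic a b c cardR.
Let e_gt0 : (0 < r * 3)%N. Proof. by rewrite muln_gt0 r_gt0. Qed.
Let QE : Q = (2 ^ (r * 3))%N. Proof. by rewrite qE expnM. Qed.

Lemma q_gt1 : (1 < q)%N.
Proof. by rewrite qE -{1}(expn0 2) ltn_exp2l. Qed.

Lemma card_zero_pair t :
  #|[set s in nonnil S | (lam s == 0) && (lam (s * t) == 0)]| =
  if in_base t then (q ^ 4 - q ^ 2)%N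
  else if near_base t then (q ^ 3 - q ^ 2)%N else (q ^ 2 - q)%N.
Proof.
set m := t.2; set n := t.1.2 + a * t.2.
have -> : #|[set s in nonnil S | (lam s == 0) && (lam (s * t) == 0)]| = #|annih m n|.
  have inj : injective (fun p : R * R => (p.1, p.2, 0) : S) by move=> [? ?] [? ?] [-> ->].
  rewrite -(card_imset _ inj); apply: eq_card => -[[s0 s1] s2].
  have lamE x y : lam (((x, y, 0) : S) * t) = x * m + y * n.
    by rewrite lam_linear_mul.
  apply/idP/imsetP => [|[[x y] h [-> -> ->]]].
    rewrite inE => /andP[h /andP[/eqP]]; rewrite {1}/lam /= => s2E; rewrite s2E in h *.
    rewrite lamE => lam0; exists (s0, s1) => //; rewrite inE /= lam0 andbT.
    by move: h; rewrite !inE -negb_and; apply: contra => /andP[/eqP h0 /eqP h1];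
      apply/eqP/cubic_nilP; rewrite /= mulr0.
  have {h} [/= h xy0] := setIdP h; apply/setIdP; split; last by rewrite lamE xy0 /lam eqxx.
  move: h; rewrite !inE -negb_and; apply: contra => /eqP/cubic_nilP[/= -> -> _].
  by rewrite eqxx.
have mn0 : in_base t = (m == 0) && (n == 0).
  rewrite /in_base andbC /m; case: eqP => //= h; congr (_ == _).
  by rewrite /n h mulr0 addr0.
have mnN : near_base t = (2 * m == 0) && (2 * n == 0).
  rewrite /near_base andbC /m; case: eqP => //= h; congr (_ == _).
  by rewrite /n mulrDr [2 * (a * _)]mulrCA h mulr0 addr0.
rewrite mn0; case: ifP => [/andP[/eqP -> /eqP ->]|/negP mnz]; first exact: card_annih0.
rewrite mnN; case: ifP => [/andP[/eqP hm /eqP hn]|/negbT]; last first.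
  by rewrite negb_and => h; apply: card_annih_unit => //; rewrite !inE.
have [m' mE] := nil_double chR hm; have [n' nE] := nil_double chR hn.
rewrite mE nE; apply: card_annih_nil => //; rewrite !inE -mE -nE -negb_and.
exact/negP.
Qed.

Lemma card_zero_lam : #|[set s in nonnil S | lam s == 0]| = (q ^ 4 - q ^ 2)%N.
Proof.
rewrite -(card_annih0 chR cardR).
have := card_zero_pair 0; rewrite (card_annih0 chR cardR) /in_base eqxx /= => <-.
by apply: eq_card => s; rewrite !inE mulr0 eqxx andbT.
Qed.

(** Multiplication by units acts like a Singer group, transitively on the lines; this reduces every
    count to the line [lam s = 0]. *)
Lemma card_translate u (P : pred S) : u \in nonnil S ->
  #|[set p in nonnil S | P (p * u)]| = #|[set s in nonnil S | P s]|.
Proof.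
move=> uU; have [v uv] := unit_nonnil chS uU.
have inj : injective ( *%R^~ u) by move=> x y; rewrite ![_ * u]mulrC; apply: unit_cancel.
rewrite -(card_imset _ inj); apply: eq_card => s; apply/imsetP/idP => [[p]|].
  by rewrite inE => /andP[h1 h2] ->; rewrite inE nonnilM // h1 uU.
rewrite inE => /andP[sU Ps]; exists (s * v).
  rewrite inE -mulrA [v * u]mulrC uv mulr1 Ps nonnilM // sU /=.
  by rewrite (nonnil_unit chS (b := u)) // mulrC.
by rewrite -mulrA [v * u]mulrC uv mulr1.
Qed.

(** For a unit t, [in_base (t * v)] says that t and u define the same line, and [near_base (t * v)]
    that their lines are neighbours. *)
Lemma card_common_zero u v t : u \in nonnil S -> u * v = 1 ->
  #|[set p in nonnil S | (lam (p * u) == 0) && (lam (p * t) == 0)]| =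
  if in_base (t * v) then (q ^ 4 - q ^ 2)%N
  else if near_base (t * v) then (q ^ 3 - q ^ 2)%N else (q ^ 2 - q)%N.
Proof.
move=> uU uv; rewrite -card_zero_pair.
rewrite -(card_translate (fun s => (lam s == 0) && (lam (s * (t * v)) == 0)) uU).
apply: eq_card => p; rewrite !inE; congr (_ && (_ && (lam _ == 0))).
by rewrite -mulrA [t * v]mulrC [u * _]mulrA uv mul1r.
Qed.

Lemma near_base_nonnil t : ~~ near_base t -> t \in nonnil S.
Proof.
rewrite inE; apply: contra => /eqP h; apply/near_baseP; exists 0.
by rewrite h rmorph0 mulr0.
Qed.

Lemma near_base_indep t x y : ~~ near_base t ->
  2 * (emb x + emb y * t) = 0 -> 2 * x = 0 /\ 2 * y = 0.
Proof.
move=> nt h; case: (boolP (y \in nonnil R)) => [/(unit_nonnil chR)[k yk]|].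
  case/negP: nt; apply/near_baseP; exists (- (x * k)).
  have eyk : emb y * emb k = 1 by rewrite -rmorphM yk rmorph1.
  have -> : 2 * t = 2 * (emb x + emb y * t) * emb k - 2 * t * (emb y * emb k - 1)
    + 2 * emb (- (x * k)) by rewrite rmorphN rmorphM; ring.
  by rewrite h eyk subrr; ring.
rewrite inE negbK => /eqP hy; split => //.
have : 2 * emb x = 0.
  rewrite -h mulrDr mulrA; have -> : 2 * emb y = 0; last by rewrite mul0r addr0.
  by rewrite -(rmorph_nat emb 2) -rmorphM hy rmorph0.
by case/cubic_nilP.
Qed.

(* The residue field of S has degree 3 over that of R, so it contains no
   element of degree 2. *)
Lemma quadratic_near_base t x y : 2 * t = 2 * (emb x + emb y * t ^+ 2) ->
  near_base t.
Proof.
move=> tE; apply/negPn/negP => nt.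
have emb2 z : 2 * emb z = emb (2 * z) by rewrite rmorphM rmorph_nat.
have [k yk] : exists k, y * k = 1.
  apply: (unit_nonnil chR); rewrite inE; apply: contraNneq nt => hy.
  by apply/near_baseP; exists x; rewrite tE mulrDr mulrA !emb2 hy rmorph0 mul0r addr0.
have eyk : emb y * emb k = 1 by rewrite -rmorphM yk rmorph1.
have t2E : 2 * t ^+ 2 = 2 * (emb k * (t - emb x)).
  have -> : 2 * t ^+ 2 = emb k * (2 * (emb x + emb y * t ^+ 2)) - 2 * emb k * emb x
    - 2 * t ^+ 2 * (emb y * emb k - 1) by ring.
  by rewrite -tE eyk subrr; ring.
(* Modulo 2, t satisfies a quadratic equation over R, and the combinations of 1 and t form a ring
   with at most q^2 residues. As S has q^3 residues, some w lies outside. *)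
have [w wN] : exists w, forall m n, 2 * w <> 2 * (emb m + emb n * t).
  pose nils := [set z : R | 2 * z == 0].
  pose im : {set S} := [set emb p.1 + emb p.2 * t | p in setX nils nils].
  have lt_im : (#|im| < #|[set s : S | (2 * s == 0)%R]|)%N.
    rewrite (card_nil chS cardS).
    have : (#|im| <= q ^ 2)%N.
      apply: leq_trans (leq_imset_card _ _) _.
      by rewrite cardsX (card_nil chR cardR) mulnn.
    by move/leq_ltn_trans; apply; rewrite ltn_exp2l // q_gt1.
  have /subsetPn[s] : ~~ ([set s : S | 2 * s == 0] \subset im).
    by apply: contraL lt_im => /subset_leq_card; rewrite -leqNgt.
  rewrite inE => /eqP/(nil_double chS)[w ->] wim; exists w => m n h.
  case/imsetP: wim; exists (2 * m, 2 * n).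
    by rewrite !inE /= !(chain4 chR) eqxx.
  by rewrite h mulrDr mulrA !emb2.
have wind x0 x1 x2 : 2 * (emb x0 + emb x1 * t + emb x2 * w) = 0 ->
    [/\ 2 * x0 = 0, 2 * x1 = 0 & 2 * x2 = 0].
  move=> h; case: (boolP (x2 \in nonnil R)) => [/(unit_nonnil chR)[l hl]|].
    exfalso; apply: (wN (- (x0 * l)) (- (x1 * l))).
    have el : emb x2 * emb l = 1 by rewrite -rmorphM hl rmorph1.
    have -> : 2 * w = 2 * (emb x0 + emb x1 * t + emb x2 * w) * emb l
      - 2 * w * (emb x2 * emb l - 1) + 2 * (emb (- (x0 * l)) + emb (- (x1 * l)) * t).
      by rewrite !rmorphN !rmorphM; ring.
    by rewrite h el subrr; ring.
  rewrite inE negbK => /eqP h2.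
  have [|-> ->] // := @near_base_indep t x0 x1 nt.
  by rewrite mulrDr [2 * (emb x2 * w)]mulrA emb2 h2 rmorph0 mul0r addr0 in h.
pose f (p : R * R * R) : S := emb p.1.1 + emb p.1.2 * t + emb p.2 * w.
have f0 p : f p = 0 -> p = 0.
  case: p => -[x0 x1] x2 h.
  have [|] := wind x0 x1 x2; first by rewrite -/(f (x0, x1, x2)) h mulr0.
  move=> /(nil_double chR)[y0 h0] /(nil_double chR)[y1 h1] /(nil_double chR)[y2 h2].
  have [|g0 g1 g2] := wind y0 y1 y2.
    by rewrite -[RHS]h /f /= h0 h1 h2 -!emb2; ring.
  by rewrite h0 h1 h2 g0 g1 g2.
have f_inj : injective f.
  move=> p p' h; apply/eqP; rewrite -subr_eq0; apply/eqP/f0.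
  have -> : f (p - p') = f p - f p' by rewrite /f /= !rmorphB; ring.
  by rewrite h subrr.
have [g gK fK] : bijective f by apply: inj_card_bij f_inj (leqnn _).
(* Now 1, t, w form a basis of S. With v the w-coordinate of [t * w], the product (t - v) w is a
   combination of 1 and t alone. *)
have := fK (t * w); case: (g (t * w)) => -[x0 x1] v; rewrite /f /= => twE.
have near_emb z : ~~ near_base (t - emb z).
  apply: contra nt => /near_baseP[z' hz]; apply/near_baseP; exists (z' + z).
  by rewrite rmorphD mulrDr -hz; ring.
(* Modulo 2 this is the norm of t - v, the other root of the quadratic equation of t being k - t.
   The norm is a unit, so multiplying (t - v) w by the conjugate k - v - t makes w a combination of
   1 and t, a contradiction. *)
pose n0 := k * x - k * v + v ^+ 2.
have n0E : 2 * emb n0 = 2 * ((t - emb v) * (emb (k - v) - t)).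
  have -> : 2 * ((t - emb v) * (emb (k - v) - t)) =
    2 * ((t - emb v) * emb (k - v) + emb v * t) - 2 * t ^+ 2 by ring.
  by rewrite t2E /n0 !(rmorphD, rmorphN, rmorphM, rmorphXn) /=; ring.
have nearN z : near_base z -> near_base (- z).
  by move=> /near_baseP[z' hz]; apply/near_baseP; exists (- z'); rewrite rmorphN !mulrN hz.
have n0U : n0 \in nonnil R.
  rewrite -(emb_nonnil a b c) inE n0E.
  have : (t - emb v) * (emb (k - v) - t) \in nonnil S.
    rewrite nonnilM // !near_base_nonnil //.
    by apply: contra (near_emb (k - v)) => /nearN; rewrite opprB.
  by rewrite inE.
have [l n0l] := unit_nonnil chR n0U.
have en0l : emb n0 * emb l = 1 by rewrite -rmorphM n0l rmorph1.
apply: (wN (l * (x0 * (k - v) + x1 * k * x)) (l * (- x1 * v - x0))).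
have -> : 2 * w = 2 * emb n0 * (emb l * w) - 2 * w * (emb n0 * emb l - 1) by ring.
rewrite en0l subrr mulr0 subr0 n0E.
have -> : 2 * ((t - emb v) * (emb (k - v) - t)) * (emb l * w) =
  2 * emb l * ((t * w - emb v * w) * (emb (k - v) - t)) by ring.
rewrite -twE.
have -> : emb x0 + emb x1 * t + emb v * w - emb v * w = emb x0 + emb x1 * t by ring.
have -> : 2 * emb l * ((emb x0 + emb x1 * t) * (emb (k - v) - t)) =
  emb l * (2 * (emb x0 * emb (k - v) + (emb x1 * emb (k - v) - emb x0) * t)
     - emb x1 * (2 * t ^+ 2)) by ring.
by rewrite t2E !(rmorphD, rmorphN, rmorphM) /=; ring.
Qed.

Notation T := (teich S Q).

Let liftT u : u \in nonnil S -> u ^+ Q \in T := @teich_lift _ chS _ cardS _ e_gt0 QE u.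
Let expQ u : 2 * u ^+ Q = 2 * u := eqm_exp_card chS cardS QE u.

Lemma in_base_near s : in_base s -> near_base s.
Proof. by case/in_baseP=> x ->; apply/near_baseP; exists x. Qed.

Lemma near_base_eqm s t : 2 * s = 2 * t -> near_base s = near_base t.
Proof. by move=> h; apply/near_baseP/near_baseP => -[x hx]; exists x; rewrite -hx h. Qed.

(** An element of T congruent to x equals x^Q, which still lies in R. Consequently distinct lines of
    the oval are never neighbours. *)
Lemma teich_near_base t : t \in T -> near_base t -> in_base t.
Proof.
move=> /teichP[_ tQ] /near_baseP[x hx]; apply/in_baseP; exists (x ^+ Q).
by rewrite rmorphXn -tQ QE; apply: eqm_expn.
Qed.

Lemma card_teich_base : #|[set t in T | near_base t]| = (q - 1)%N.
Proof.
have <- : #|[set 2 * t | t in [set t in T | near_base t]]| = #|[set t in T | near_base t]|.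
  apply: card_in_imset => t u /setIdP[tT _] /setIdP[uT _].
  exact: (teich_inj chS e_gt0 QE).
have <- : #|[set x : R | 2 * x == 0] :\ 0| = (q - 1)%N.
  rewrite -(card_nil chR cardR) [in RHS](cardsD1 0 [set x : R | _]).
  by rewrite [0 \in _]inE mulr0 eqxx addKn.
rewrite -(card_imset _ (@emb_inj R a b c)); apply: eq_card => s.
apply/imsetP/imsetP => [[t /setIdP[/teichP[tU _] /near_baseP[x hx]] ->]|[x]].
  exists (2 * x); last by rewrite hx rmorphM rmorph_nat.
  rewrite !inE chain4 // eqxx andbT -(inj_eq (@emb_inj R a b c)) rmorphM rmorph_nat -hx.
  by rewrite inE in tU; rewrite rmorph0.
rewrite !inE => /andP[x0 /eqP/(nil_double chR)[y xE]] ->.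
have yT : emb y ^+ Q \in T.
  by apply: liftT; rewrite emb_nonnil inE -xE.
exists (emb y ^+ Q); last by rewrite xE rmorphM rmorph_nat expQ.
apply/setIdP; split=> //; apply/near_baseP; exists y.
by rewrite expQ.
Qed.

(** Replacing [v] by its Teichmueller lift, congruent to it, shifts the set onto the elements of T
    in R. So each neighbour class contains exactly one member of the oval. *)
Lemma card_teich_near u v : u * v = 1 ->
  #|[set t in T | near_base (t * v)]| = (q - 1)%N.
Proof.
move=> uv; have vU : v \in nonnil S by apply: (@nonnil_unit _ chS _ u); rewrite mulrC.
have uU : u \in nonnil S by apply: (@nonnil_unit _ chS _ v).
have vT := liftT vU.
have uT := liftT uU.
have uvQ : u ^+ Q * v ^+ Q = 1 by rewrite -exprMn uv expr1n.
have vE : 2 * v ^+ Q = 2 * v := expQ v.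
have nearE t : near_base (t * v) = near_base (t * v ^+ Q).
  by apply: near_base_eqm; rewrite ![2 * (t * _)]mulrCA vE.
rewrite -card_teich_base.
have inj : injective ( *%R^~ (v ^+ Q)).
  move=> x y; rewrite ![_ * v ^+ Q]mulrC; apply: unit_cancel => //.
  by case/teichP: vT.
rewrite -(card_imset _ inj); apply: eq_card => s; apply/imsetP/idP => [[t]|].
  by move=> /setIdP[tT nt] ->; apply/setIdP; rewrite -nearE teichM.
move=> /setIdP[sT ns]; exists (s * u ^+ Q).
  by apply/setIdP; rewrite nearE teichM // -mulrA uvQ mulr1.
by rewrite -mulrA uvQ mulr1.
Qed.

Lemma card_kernel p : p \in nonnil S -> #|[set s | lam (p * s) == 0]| = (q ^ 4)%N.
Proof.
move=> pU; have [w pw] := unit_nonnil chS pU.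
have -> : (q ^ 4)%N = #|{: R * R}| by rewrite card_prod cardR -expnD.
pose f (z : R * R) : S := w * ((z.1, z.2, 0) : S).
have finj : injective f.
  move=> [x y] [x' y'] /(congr1 ( *%R p)); rewrite /f !mulrA pw !mul1r.
  by case=> -> ->.
rewrite -(card_imset _ finj); apply: eq_card => s; apply/idP/imsetP.
  rewrite inE; case E : (p * s) => [[x y] z]; rewrite /lam /= => /eqP zE.
  by exists (x, y) => //; rewrite /f /= -zE -E mulrA [w * p]mulrC pw mul1r.
by case=> z _ ->; rewrite inE /f mulrA pw mul1r.
Qed.

(** The combinations of 1 and t all lie in the kernel of s -> lam (p s), are pairwise distinct, and
    number q^4, the size of that kernel. *)
Lemma span_kernel p s t : p \in nonnil S -> lam p = 0 -> lam (p * t) = 0 ->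
  ~~ near_base t -> lam (p * s) = 0 -> exists x y, s = emb x + emb y * t.
Proof.
move=> pU p0 pt nt ps; pose f (z : R * R) : S := emb z.1 + emb z.2 * t.
have f_inj : injective f.
  move=> [x y] [x' y'] h.
  have {h}: emb (x - x') + emb (y - y') * t = 0.
    by move/eqP: h; rewrite -subr_eq0 => /eqP <-; rewrite /f /= !rmorphB; ring.
  move: (x - x') (subrK x' x) (y - y') (subrK y' y) => {x y} x <- y <- h.
  have emb2 z : emb (2 * z) = 2 * emb z by rewrite rmorphM rmorph_nat.
  have [|/(nil_double chR)[x1 xE] /(nil_double chR)[y1 yE]] := @near_base_indep t x y nt.
    by rewrite h mulr0.
  have [|x10 y10] := @near_base_indep t x1 y1 nt.
    by rewrite -[RHS]h xE yE !emb2; ring.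
  by rewrite xE yE x10 y10 !add0r.
have : s \in [set f z | z : R * R].
  suff -> : [set f z | z : R * R] = [set s | lam (p * s) == 0] by rewrite inE ps.
  apply/eqP; rewrite eqEcard card_kernel // card_imset // card_prod cardR -expnD leqnn andbT.
  apply/subsetP => _ /imsetP[z _ ->]; rewrite inE /f mulrDr.
  have -> : p * emb z.1 = emb z.1 * p by rewrite mulrC.
  have -> : p * (emb z.2 * t) = emb z.2 * (p * t) by rewrite mulrCA.
  by rewrite raddfD /= !lam_emb p0 pt !mulr0 addr0.
by case/imsetP=> -[x y] _ ->; exists x, y.
Qed.

(** The lines of 1, s and t pass through p, so t = x + y s. If x or y is not a unit, two of the
    lines are neighbours. Otherwise write x = x' + 2 x1 and y = y' + 2 y1 with x', y' Teichmueller
    units. [teich_add] gives t = x' + y' s + 2 w with w^2 congruent to x' y' s, while comparison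
    shows w congruent to x1 + y1 s. Squaring yields a quadratic equation for s modulo 2. *)
Lemma no_three_collinear p s t : p \in nonnil S -> s \in T -> t \in T ->
  lam p = 0 -> lam (p * s) = 0 -> lam (p * t) = 0 ->
  ~~ near_base s -> ~~ near_base t -> exists x, 2 * t = 2 * (emb x * s).
Proof.
move=> pU sT tT p0 ps pt ns nt; have [x [y tE]] := span_kernel pU p0 ps ns pt.
have emb2 z : 2 * emb z = emb (2 * z) by rewrite rmorphM rmorph_nat.
case: (boolP (x \in nonnil R)) => [xU|]; last first.
  rewrite inE negbK => /eqP x0; exists y.
  by rewrite tE mulrDr emb2 x0 rmorph0 add0r.
case: (boolP (y \in nonnil R)) => [yU|]; last first.
  rewrite inE negbK => /eqP y0; case/negP: nt; apply/near_baseP; exists x.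
  by rewrite tE mulrDr mulrA [2 * emb y]emb2 y0 rmorph0 mul0r addr0.
case/negP: ns; set x' := x ^+ Q; set y' := y ^+ Q.
have liftE (z : R) : exists z1, z = z ^+ Q + 2 * z1.
  have [|z1 h] := nil_double chR (a := z - z ^+ Q); last by exists z1; rewrite -h; ring.
  apply: (@emb_inj R a b c); rewrite -emb2 rmorphB mulrBr rmorphXn.
  by rewrite expQ subrr rmorph0.
have embT (z : R) : z \in nonnil R -> emb (z ^+ Q) \in T.
  by move=> zU; rewrite rmorphXn liftT // emb_nonnil.
have [x1 xE] := liftE x; have [y1 yE] := liftE y.
have exE : emb x = emb (x ^+ Q) + 2 * emb x1 by rewrite {1}xE rmorphD emb2.
have eyE : emb y = emb (y ^+ Q) + 2 * emb y1 by rewrite {1}yE rmorphD emb2.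
have [|w tE' wE] := teich_add chS e_gt0 QE (embT x xU) (teichM chS (embT y yU) sT) tT.
  rewrite tE exE eyE.
  have -> : 2 * (emb (x ^+ Q) + 2 * emb x1 + (emb (y ^+ Q) + 2 * emb y1) * s) =
    2 * (emb (x ^+ Q) + emb (y ^+ Q) * s) + 2 * (2 * (emb x1 + emb y1 * s)) by ring.
  by rewrite chain4 // addr0.
have w2 : 2 * w = 2 * (emb x1 + emb y1 * s).
  have -> : 2 * w = t - (emb (x ^+ Q) + emb (y ^+ Q) * s) by rewrite tE'; ring.
  by rewrite tE exE eyE; ring.
have xyU : x' * y' \in nonnil R.
  rewrite -(emb_nonnil a b c) rmorphM nonnilM //.
  by have /teichP[-> _] := embT x xU; have /teichP[-> _] := embT y yU.
have [k xyk] := unit_nonnil chR xyU.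
have exyk : emb x' * emb y' * emb k = 1 by rewrite -!rmorphM xyk rmorph1.
apply: (@quadratic_near_base s (k * x1 ^+ 2) (k * y1 ^+ 2)).
have -> : 2 * s = 2 * (emb x' * (emb y' * s)) * emb k
  - 2 * s * (emb x' * emb y' * emb k - 1) by ring.
rewrite exyk subrr mulr0 subr0 -wE (eqm_sqr chS w2) !(rmorphM, rmorphXn) /=.
have -> : 2 * (emb x1 + emb y1 * s) ^+ 2 * emb k =
  2 * (emb k * emb x1 ^+ 2 + emb k * emb y1 ^+ 2 * s ^+ 2)
  + 2 * (2 * (emb x1 * emb y1 * s * emb k)) by ring.
by rewrite chain4 // addr0.
Qed.

(* The point p is on oval_deg p / (q - 1) lines of the dual hyperoval, since
   the q - 1 elements of T in R t define the same line as t. *)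
Definition oval_deg p : nat := #|[set t in T | lam (p * t) == 0]|.

(** A neighbour class holds q - 1 elements of T, so it suffices to cover the oval lines through p by
    two classes: that of some t0 and that of some t1 not a neighbour of t0. *)
Lemma oval_deg_le p : p \in nonnil S -> (oval_deg p <= 2 * (q - 1))%N.
Proof.
move=> pU; rewrite /oval_deg; set C := [set t in T | _].
case: (set_0Vmem C) => [->|[t0 t0C]]; first by rewrite cards0.
have [t0T /eqP pt0] := setIdP t0C; have [t0U _] := teichP t0T.
have [v0 tv0] := unit_nonnil chS t0U; have v0T := teich_inv chS t0T tv0.
case: (boolP (C \subset [set t in T | near_base (t * v0)])) => [/subset_leq_card|].
  rewrite (card_teich_near tv0) => /leq_trans; apply.
  by rewrite leq_pmull.
case/subsetPn=> t1 t1C; have [t1T /eqP pt1] := setIdP t1C.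
rewrite inE t1T /= => n1; have [t1U _] := teichP t1T.
have [v1 tv1] := unit_nonnil chS t1U.
have /subset_leq_card/leq_trans -> // : C \subset
    [set t in T | near_base (t * v0)] :|: [set t in T | near_base (t * v1)].
  apply/subsetP => t /setIdP[tT /eqP pt]; apply/setUP.
  case: (boolP (near_base (t * v0))) => nt; [left|right]; apply/setIdP; split=> //.
  (* Moving p to p t0 and dividing the lines by t0 makes one of the three lines that of 1. *)
  have mul0 s : p * t0 * (s * v0) = p * s.
    by rewrite [s * v0]mulrC -mulrA [t0 * _]mulrA tv0 mul1r.
  have [||||||||x hx] := @no_three_collinear (p * t0) (t1 * v0) (t * v0);
    rewrite ?mul0 ?nonnilM ?pU ?teichM //.
  apply/near_baseP; exists x.
  have -> : 2 * (t * v1) = 2 * (t * v0) * (t0 * v1) - 2 * t * v1 * (t0 * v0 - 1) by ring.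
  rewrite hx tv0 subrr mulr0 subr0.
  have -> : 2 * (emb x * (t1 * v0)) * (t0 * v1) = 2 * emb x * ((t0 * v0) * (t1 * v1)) by ring.
  by rewrite tv0 tv1 !mulr1.
apply: leq_trans (leq_card_setU _ _) _.
by rewrite (card_teich_near tv0) (card_teich_near tv1) mul2n addnn.
Qed.

Lemma sum_oval_deg (P : pred S) :
  (\sum_(p in nonnil S | P p) oval_deg p =
   \sum_(t in T) #|[set p in nonnil S | P p && (lam (p * t)%R == 0%R)]|)%N.
Proof.
rewrite (eq_bigr (fun p => \sum_(t in T) (lam (p * t)%R == 0%R))%N); last first.
  by move=> p _; rewrite /oval_deg card_setId_sum.
rewrite exchange_big; apply: eq_bigr => t _.
rewrite card_setId_sum big_mkcondr; apply: eq_bigr => p _.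
by case: (P p).
Qed.

(** Of the q^3 - 1 elements of T, q - 1 are neighbours of u and contribute [k] each; the others meet
    the line of u in a single point, that is in q^2 - q units. Leaving [k] open covers both an oval
    line and a line that only neighbours one. *)
Lemma sum_oval_deg_line u v k : u * v = 1 ->
  (forall t, t \in T -> near_base (t * v) ->
     #|[set p in nonnil S | (lam (p * u) == 0) && (lam (p * t) == 0)]| = k) ->
  (\sum_(p in nonnil S | lam (p * u)%R == 0%R) oval_deg p =
   (q - 1) * k + (q ^ 3 - q) * (q ^ 2 - q))%N.
Proof.
move=> uv nearE; have uU : u \in nonnil S by apply: (@nonnil_unit _ chS _ v).
rewrite sum_oval_deg; set A := [set t in T | near_base (t * v)].
have sAT : A \subset T by apply/subsetP => t /setIdP[].
rewrite (big_setID A) (setIidPr sAT) /=; congr addn.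
  rewrite (eq_bigr (fun=> k)); last by move=> t /setIdP[]; apply: nearE.
  by rewrite sum_nat_const /A (card_teich_near uv).
rewrite (eq_bigr (fun=> q ^ 2 - q)%N).
  rewrite sum_nat_const cardsDS // (card_teich chS cardS e_gt0 QE) /A (card_teich_near uv).
  by rewrite subnBA ?subnK // ?expn_gt0 ltnW ?q_gt1.
move=> t /setDP[tT ntA]; rewrite (card_common_zero _ uU uv).
have nt : ~~ near_base (t * v) by apply: contra ntA => h; apply/setIdP.
by rewrite (negPf nt) (contraNF (@in_base_near _) nt).
Qed.

(* Equality throughout in the count of incident pairs on the line of u. *)
Lemma oval_deg_on u p : u \in T -> p \in nonnil S -> lam (p * u) = 0 ->
  oval_deg p = (2 * (q - 1))%N.
Proof.
move=> uT pU pu; have [uU _] := teichP uT.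
have [v uv] := unit_nonnil chS uU; have vT := teich_inv chS uT uv.
have sumE : (\sum_(p in nonnil S | lam (p * u)%R == 0%R) oval_deg p =
             \sum_(p in nonnil S | lam (p * u)%R == 0%R) 2 * (q - 1))%N.
  rewrite (sum_oval_deg_line (k := (q ^ 4 - q ^ 2)%N) uv); last first.
    move=> t tT nt; rewrite (card_common_zero _ uU uv).
    by rewrite teich_near_base ?teichM.
  rewrite sum_nat_cond_const.
  rewrite (card_translate (fun s => lam s == 0) uU) card_zero_lam.
  by rewrite expn4_sub_expn2 expn3_sub expn2_sub; ring.
have := leqif_sum (fun p (h : (p \in nonnil S) && (lam (p * u) == 0)) =>
  leqif_eq (oval_deg_le (proj1 (andP h)))).
case=> _; rewrite sumE eqxx => /esym/forallP/(_ p).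
by rewrite pU pu eqxx => /eqP.
Qed.

Lemma oval_deg_cases p : p \in nonnil S ->
  oval_deg p = 0%N \/ oval_deg p = (2 * (q - 1))%N.
Proof.
move=> pU; case: (posnP (oval_deg p)) => [|/card_gt0P[t]]; first by left.
by move=> /setIdP[tT /eqP pt]; right; apply: oval_deg_on pt.
Qed.

Definition oval_free : {set S} := [set p in nonnil S | oval_deg p == 0%N].

Lemma sum_oval_deg_free (P : pred S) :
  (\sum_(p in nonnil S | P p) oval_deg p + #|[set p in oval_free | P p]| * (2 * (q - 1)) =
   #|[set p in nonnil S | P p]| * (2 * (q - 1)))%N.
Proof.
rewrite !card_setId_sum !big_distrl /= [X in (_ + X)%N]big_mkcond /=.
rewrite [X in (X + _)%N]big_mkcond [RHS]big_mkcond -big_split; apply: eq_bigr => p _ /=.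
have -> : (p \in oval_free) = (p \in nonnil S) && (oval_deg p == 0%N) by exact: in_set.
case: (boolP (p \in nonnil S)) => //= pU; have [->|->] := oval_deg_cases pU; rewrite ?eqxx; first by case: (P p).
have -> : (2 * (q - 1) == 0)%N = false by rewrite muln_eq0 subn_eq0 leqNgt q_gt1.
by case: (P p); rewrite ?mul1n addn0.
Qed.

Lemma card_oval_free : (2 * #|oval_free| = (q ^ 3 - 1) * (q ^ 2 * (q - 1)))%N.
Proof.
have := sum_oval_deg_free predT; rewrite sum_oval_deg.
rewrite (eq_bigr (fun=> q ^ 4 - q ^ 2)%N); last first.
  move=> t /teichP[tU _]; rewrite -card_zero_lam -(card_translate (fun s => lam s == 0) tU).
  by apply: eq_card => p; rewrite !inE.
have setT' (A : {set S}) : #|[set p in A | predT p]| = #|A|.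
  by apply: eq_card => p; rewrite !inE andbT.
rewrite !setT' sum_nat_const (card_teich chS cardS e_gt0 QE) (card_nonnil chS cardS).
rewrite expn4_sub_expn2 expn2_sub expn3_sub1.
have : (0 < q - 1)%N by rewrite subn_gt0 q_gt1.
case: (q) => // d; rewrite subSS subn0 => d0 h; apply/eqP; rewrite -(eqn_pmul2r d0).
by apply/eqP; move: h; lia.
Qed.

Lemma oval_free_line_empty u t x : t \in T -> t = emb x * u ->
  [set p in oval_free | lam (p * u) == 0] = set0.
Proof.
move=> tT tE; apply/setP => p; rewrite [RHS]inE; apply/negP => /setIdP[/setIdP[_]].
rewrite cards_eq0 => /eqP/setP/(_ t); rewrite [RHS]inE => /negP h /eqP pu; apply: h.
by apply/setIdP; rewrite tE mulrCA lam_emb pu mulr0 -tE.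
Qed.

Lemma card_oval_free_line u v : u * v = 1 ->
  [set p in oval_free | lam (p * u) == 0] = set0 \/
  (2 * #|[set p in oval_free | lam (p * u)%R == 0%R]| = q ^ 3 * (q - 1))%N.
Proof.
move=> uv; have uU : u \in nonnil S by apply: (@nonnil_unit _ chS _ v).
case: (boolP [exists t in T, in_base (t * v)]) => [|noT].
  case/exists_inP => t tT /in_baseP[x tv]; left.
  by apply: (@oval_free_line_empty _ t x) => //; rewrite -tv -mulrA [v * u]mulrC uv mulr1.
right; have := sum_oval_deg_free (fun p => lam (p * u) == 0).
rewrite (sum_oval_deg_line (k := (q ^ 3 - q ^ 2)%N) uv); last first.
  move=> t tT nt; rewrite (card_common_zero _ uU uv) nt.
  by case: ifP => // h; case/negP: noT; apply/exists_inP; exists t.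
rewrite (card_translate (fun s => lam s == 0) uU) card_zero_lam.
rewrite expn4_sub_expn2 expn2_sub expn3_sub expn3_sub_expn2.
have : (0 < q - 1)%N by rewrite subn_gt0 q_gt1.
move: #|[set p in oval_free | _]| => g; case: (q) => // d; rewrite subSS subn0 => d0 h; apply/eqP; rewrite -(eqn_pmul2r d0).
by apply/eqP; move: h; lia.
Qed.

(** * Points and lines of the plane inside the cubic extension *)

Definition vec_cubic (x : 'rV[R]_3) : S := (x 0 0, x 0 1, x 0 2).

Definition cubic_vec (s : S) : 'rV[R]_3 :=
  \row_j (if j == 0 then s.1.1 else if j == 1 then s.1.2 else s.2).

Lemma vec_cubicK : cancel vec_cubic cubic_vec.
Proof.
move=> x; apply/rowP => j; rewrite mxE /=.
by case: j => -[|[|[|//]]] jlt; congr (x _ _); apply/val_inj.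
Qed.

Lemma cubic_vecK : cancel cubic_vec vec_cubic.
Proof. by case=> -[s0 s1] s2; congr (_, _, _); rewrite mxE. Qed.

Lemma vec_cubicD (x y : 'rV[R]_3) : vec_cubic (x + y) = vec_cubic x + vec_cubic y.
Proof. by congr (_, _, _); rewrite mxE. Qed.

Lemma vec_cubicZ k (x : 'rV[R]_3) : vec_cubic (k *: x) = emb k * vec_cubic x.
Proof. by rewrite emb_mul; congr (_, _, _); rewrite mxE. Qed.

Lemma vec_cubic0 : vec_cubic 0 = 0.
Proof. by congr (_, _, _); rewrite mxE. Qed.

Lemma vec_cubic_eq0 (x : 'rV[R]_3) : (vec_cubic x == 0) = (x == 0).
Proof. by rewrite -(inj_eq (can_inj vec_cubicK)) vec_cubic0. Qed.

Definition pt s : {set 'rV[R]_3} := [set k *: cubic_vec s | k : R].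

Definition kerline u : {set 'rV[R]_3} := [set x | lam (vec_cubic x * u) == 0].

Lemma pt_sub_kerline s u : (pt s \subset kerline u) = (lam (s * u) == 0).
Proof.
apply/subsetP/eqP => [h|h _ /imsetP[k _ ->]].
  have /h : cubic_vec s \in pt s by apply/imsetP; exists 1; rewrite ?scale1r.
  by rewrite inE cubic_vecK => /eqP.
by rewrite inE vec_cubicZ cubic_vecK -mulrA lam_emb h mulr0.
Qed.

Lemma eq_pt s t : s \in nonnil S ->
  (pt t == pt s) = [exists k in nonnil R, t == emb k * s].
Proof.
move=> sU; apply/eqP/exists_inP => [h|[k kU /eqP ->]].
  have : cubic_vec t \in pt s by rewrite -h; apply/imsetP; exists 1; rewrite ?scale1r.
  case/imsetP=> k _ tE; have {}tE : t = emb k * s.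
    by rewrite -[t]cubic_vecK tE vec_cubicZ cubic_vecK.
  exists k; rewrite ?tE //.
  have : cubic_vec s \in pt t by rewrite h; apply/imsetP; exists 1; rewrite ?scale1r.
  case/imsetP=> l _ sE; have {}sE : s = emb l * t.
    by rewrite -[s]cubic_vecK sE vec_cubicZ cubic_vecK.
  by move: sU; rewrite sE tE !nonnilM // !emb_nonnil => /and3P[].
have [l kl] := unit_nonnil chR kU.
have tE : cubic_vec (emb k * s) = k *: cubic_vec s.
  by apply: (can_inj vec_cubicK); rewrite vec_cubicZ !cubic_vecK.
apply/setP => x; apply/imsetP/imsetP => -[m _ ->].
  by exists (m * k) => //; rewrite tE scalerA.
by exists (m * l) => //; rewrite tE scalerA -mulrA [l * k]mulrC kl mulr1.
Qed.

Lemma is_pointP P : reflect (exists2 s, s \in nonnil S & P = pt s) (is_point P).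
Proof.
apply: (iffP existsP) => [[x /andP[/eqP -> /forallP fr]]|[s sU ->]].
  exists (vec_cubic x); last by rewrite /pt vec_cubicK.
  rewrite inE -(rmorph_nat emb 2) -vec_cubicZ vec_cubic_eq0.
  by apply/negP => h; have := fr 2; rewrite h => /eqP; apply: two_neq0.
exists (cubic_vec s); rewrite eqxx; apply/forallP => k; apply/implyP.
rewrite -vec_cubic_eq0 vec_cubicZ cubic_vecK => /eqP h; apply/eqP.
apply: (@emb_inj R a b c); rewrite rmorph0; apply: (unit_cancel chS sU).
by rewrite mulr0 mulrC.
Qed.

Lemma kerline_is_line u : u \in nonnil S -> is_line (kerline u).
Proof.
move=> uU; have [v uv] := unit_nonnil chS uU; pose X : S := (0, 1, 0).
have vU : v \in nonnil S by apply: (@nonnil_unit _ chS _ u); rewrite mulrC.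
have lin k l : vec_cubic (k *: cubic_vec v + l *: cubic_vec (X * v)) = ((k, l, 0) : S) * v.
  rewrite vec_cubicD !vec_cubicZ !cubic_vecK mulrA -mulrDl; congr (_ * _).
  by rewrite emb_mul; congr (_, _, _); rewrite /=; ring.
(* The kernel of s -> lam (s u) is v times the kernel of [lam], whose basis is 1, X. *)
apply/existsP; exists (cubic_vec v); apply/existsP; exists (cubic_vec (X * v)).
apply/andP; split.
  apply/eqP/setP => x; rewrite inE; apply/eqP/imset2P => [|[k l _ _ ->]].
    case E : (vec_cubic x * u) => [[k l] m]; rewrite /lam /= => m0.
    exists k l => //; apply: (can_inj vec_cubicK).
    by rewrite lin -m0 -E -mulrA uv mulr1.
  by rewrite lin -mulrA [v * u]mulrC uv mulr1.
apply/forallP => k; apply/forallP => l; apply/implyP.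
rewrite -vec_cubic_eq0 lin mulrC => /eqP h.
have : ((k, l, 0) : S) = 0 by apply: (unit_cancel chS vU); rewrite h mulr0.
by case=> -> ->; rewrite eqxx.
Qed.

Lemma card_kerline u : u \in nonnil S -> #|kerline u| = (q ^ 4)%N.
Proof.
move=> uU; rewrite -(card_kernel uU) -(card_imset _ (can_inj vec_cubicK)).
apply: eq_card => s; apply/imsetP/idP => [[x]|]; first by rewrite !inE mulrC => h ->.
rewrite inE mulrC => h; exists (cubic_vec s); last by rewrite cubic_vecK.
by rewrite inE cubic_vecK.
Qed.

(** By the symmetry of lam (u s) in u and s, the count of common points of two lines also produces a
    line through two points that are not neighbours. The generators of L are such points: if t were
    congruent to k s, then 2 k s - 2 t = 0 would be a nontrivial relation. Cardinalities then force
    equality. *)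
Lemma is_lineP L : is_line L -> exists2 u, u \in nonnil S & L = kerline u.
Proof.
case/existsP=> x /existsP[y /andP[/eqP LE /forallP fr]].
have {}fr k l : k *: x + l *: y = 0 -> k = 0 /\ l = 0.
  by move=> h; have /forallP/(_ l) := fr k; rewrite h eqxx => /andP[/eqP -> /eqP ->].
pose s := vec_cubic x; pose t := vec_cubic y.
have sU : s \in nonnil S.
  rewrite inE -(rmorph_nat emb 2) -vec_cubicZ vec_cubic_eq0; apply/eqP => h.
  have [|h2 _] := fr 2 0; first by rewrite h scale0r addr0.
  exact: (two_neq0 chR).
have [w sw] := unit_nonnil chS sU.
have ntw : ~~ near_base (t * w).
  apply/near_baseP => -[k hk]; have [|_] := fr (2 * k) (- 2).
    apply/eqP; rewrite -vec_cubic_eq0 vec_cubicD !vec_cubicZ -/s -/t.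
    rewrite rmorphN rmorphM rmorph_nat mulNr subr_eq0; apply/eqP.
    by rewrite -hk -!mulrA [w * s]mulrC sw mulr1.
  by move/eqP; rewrite oppr_eq0 => /eqP; apply: two_neq0.
have : (0 < #|[set p in nonnil S | (lam (p * s)%R == 0%R) && (lam (p * t)%R == 0%R)]|)%N.
  rewrite (card_common_zero _ sU sw) (negPf ntw) (contraNF (@in_base_near _) ntw).
  by rewrite subn_gt0 -{1}(expn1 q) ltn_exp2l // q_gt1.
case/card_gt0P=> u /setIdP[uU /andP[/eqP us /eqP ut]]; exists u => //.
apply/eqP; rewrite eqEcard card_kerline // LE; apply/andP; split.
  apply/subsetP => _ /imset2P[k l _ _ ->]; rewrite inE vec_cubicD !vec_cubicZ.
  by rewrite mulrDl -!mulrA raddfD /= !lam_emb -/s -/t ![_ * u]mulrC us ut !mulr0 addr0.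
have -> : [set k *: x + l *: y | k : R, l : R] =
    [set z.1 *: x + z.2 *: y | z : R * R].
  apply/setP => z; apply/imset2P/imsetP => [[k l _ _ ->]|[[k l] _ ->]].
    by exists (k, l).
  by exists k l.
rewrite card_imset ?card_prod ?cardR -?expnD // => -[k l] [k' l'] /= h.
have [|/eqP + /eqP] := fr (k - k') (l - l'); last by rewrite !subr_eq0 => /eqP -> /eqP ->.
by rewrite !scalerBl addrACA -opprD h subrr.
Qed.

(** The generators of a point form one free orbit of the unit group of R, which has order
    [q ^ 2 - q]. *)
Lemma card_points (A : {set S}) : A \subset nonnil S ->
  (forall k s, k \in nonnil R -> s \in A -> emb k * s \in A) ->
  #|A| = (#|[set pt s | s in A]| * (q ^ 2 - q))%N.
Proof.
move=> /subsetP AU Acl; rewrite -sum1_card (partition_big_imset pt) /=.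
rewrite -sum_nat_const; apply: eq_bigr => P /imsetP[s sA ->].
rewrite sum1dep_card -(card_nonnil chR cardR).
have sU := AU s sA.
have inj : injective (fun k => emb k * s).
  move=> k k'; rewrite ![_ * s]mulrC => /(unit_cancel chS sU); exact: emb_inj.
rewrite -(card_imset _ inj); apply: eq_card => t; rewrite !inE eq_pt //.
apply/andP/imsetP => [[tA /exists_inP[k kU /eqP ->]]|[k kU ->]]; first by exists k.
by split; [exact: Acl | apply/exists_inP; exists k].
Qed.

Lemma lam_unitM k s : k \in nonnil R -> (lam (emb k * s) == 0) = (lam s == 0).
Proof.
move=> kU; rewrite lam_emb; apply/eqP/eqP => [h|->]; last by rewrite mulr0.
by apply: (unit_cancel chR kU); rewrite h mulr0.
Qed.

Lemma oval_free_unitM k s : k \in nonnil R -> s \in oval_free -> emb k * s \in oval_free.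
Proof.
move=> kU /setIdP[sU s0]; apply/setIdP; split; first by rewrite nonnilM // emb_nonnil kU.
suff -> : oval_deg (emb k * s) = oval_deg s by [].
apply: eq_card => t; apply/setIdP/setIdP => -[tT h]; split=> //; move: h;
  by rewrite -mulrA lam_unitM.
Qed.

Lemma oval_free_nonnil : oval_free \subset nonnil S.
Proof. by apply/subsetP => s /setIdP[]. Qed.

Definition oval_arc : {set {set 'rV[R]_3}} := [set pt s | s in oval_free].

Let half_sqr : (2 * (q ^ 2 %/ 2) = q ^ 2)%N.
Proof.
rewrite mulnC divnK // dvdn_exp //.
by rewrite qE -(prednK r_gt0) expnS dvdn_mulr.
Qed.

Lemma card_oval_arc : (2 * #|oval_arc| = q ^ 4 - q)%N.
Proof.
have := card_oval_free; rewrite (card_points oval_free_nonnil); last exact: oval_free_unitM.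
have q1 := q_gt1; rewrite -/oval_arc; move: #|oval_arc| q1 => g.
case: (q) => [|[|d]] // _; rewrite expn2_sub expn3_sub1 subn1 /= => h.
have e0 : (0 < d.+2 * d.+1)%N by [].
apply/eqP; rewrite -(eqn_pmul2r e0); apply/eqP; rewrite -mulnA h; lia.
Qed.

Lemma meet_oval_arc u : u \in nonnil S ->
  meet oval_arc (kerline u) = 0%N \/ meet oval_arc (kerline u) = (q ^ 2 %/ 2)%N.
Proof.
move=> uU; have [v uv] := unit_nonnil chS uU.
pose A := [set p in oval_free | lam (p * u) == 0].
have -> : meet oval_arc (kerline u) = #|[set pt s | s in A]|.
  apply: eq_card => P; apply/setIdP/imsetP => [[/imsetP[s sF ->]]|[s]].
    by rewrite pt_sub_kerline => h; exists s => //; apply/setIdP.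
  by move=> /setIdP[sF h] ->; rewrite pt_sub_kerline imset_f.
have AE : #|A| = (#|[set pt s | s in A]| * (q ^ 2 - q))%N.
  apply: card_points => [|k s kU /setIdP[sF h]].
    by apply: subset_trans oval_free_nonnil; apply/subsetP => s /setIdP[].
  by apply/setIdP; rewrite -mulrA lam_unitM ?oval_free_unitM.
have [A0|] := card_oval_free_line uv.
  by left; rewrite [A]A0 imset0 cards0.
rewrite -/A AE => h; right; apply/eqP; rewrite -(eqn_pmul2l (isT : 0 < 2)%N) half_sqr.
have q1 := q_gt1; have e0 : (0 < q ^ 2 - q)%N.
  by rewrite subn_gt0 -{1}(expn1 q) ltn_exp2l.
by rewrite -(eqn_pmul2r e0) -mulnA h expn2_sub mulnA -expnSr.
Qed.

Lemma oval_arc_is_arc : is_arc oval_arc (q ^ 2 %/ 2).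
Proof.
apply/andP; split.
  apply/forall_inP => _ /imsetP[s /setIdP[sU _] ->]; apply/is_pointP; exists s => //.
apply/forallP => L; apply/implyP => /is_lineP[u uU ->].
by have [->|->] := meet_oval_arc uU.
Qed.

(** * Neighbour classes and the upper bound *)

Definition neighbour s t : bool := [exists k, 2 * s == 2 * (emb k * t)].

Lemma neighbourE s t v : t * v = 1 -> neighbour s t = near_base (s * v).
Proof.
move=> tv; apply/existsP/near_baseP => -[k].
  by move/eqP=> h; exists k; rewrite mulrA h -!mulrA tv mulr1.
move=> h; exists k; apply/eqP; have -> : 2 * s = 2 * (s * v) * t - 2 * s * (t * v - 1) by ring.
by rewrite h tv subrr mulr0 subr0 mulrA.
Qed.

(** When s is a unit, the scalar k cannot lie in the maximal ideal and is therefore invertible. *)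
Lemma neighbour_sym s t : s \in nonnil S -> neighbour s t -> neighbour t s.
Proof.
move=> sU /existsP[k /eqP h].
have : k \in nonnil R.
  move: sU; rewrite -(emb_nonnil a b c) inE h => kt; apply: contraNT kt.
  by rewrite inE negbK => /eqP k0; rewrite mulrA k0 mul0r.
case/(unit_nonnil chR)=> l kl; apply/existsP; exists l; apply/eqP.
have ekl : emb k * emb l = 1 by rewrite -rmorphM kl rmorph1.
rewrite [RHS]mulrCA h.
have -> : emb l * (2 * (emb k * t)) = 2 * t * (emb k * emb l) by ring.
by rewrite ekl mulr1.
Qed.

Lemma neighbour_trans s t u : neighbour s t -> neighbour t u -> neighbour s u.
Proof.
move=> /existsP[k /eqP hk] /existsP[l /eqP hl]; apply/existsP; exists (k * l).
by apply/eqP; rewrite hk mulrCA hl rmorphM; ring.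
Qed.

Section ArcBound.
Variables (K : {set {set 'rV[R]_3}}) (n : nat).
Hypothesis arcK : is_arc K n.
Hypothesis nE : (2 * n = q ^ 2)%N.

Notation D := (q ^ 2 - q)%N.

Let V : {set S} := [set s in nonnil S | pt s \in K].

Let V_nonnil : V \subset nonnil S.
Proof. by apply/subsetP => s /setIdP[]. Qed.

Let V_unitM k s : k \in nonnil R -> s \in V -> emb k * s \in V.
Proof.
move=> kU /setIdP[sU sK]; apply/setIdP; split; first by rewrite nonnilM // emb_nonnil kU.
suff /eqP -> : pt (emb k * s) == pt s by [].
by rewrite eq_pt //; apply/exists_inP; exists k.
Qed.

Let cardV : #|V| = (#|K| * D)%N.
Proof.
rewrite (card_points V_nonnil V_unitM); suff -> : [set pt s | s in V] = K by [].
have /andP[/forall_inP ptK _] := arcK.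
apply/eqP; rewrite eqEsubset; apply/andP; split.
  by apply/subsetP => _ /imsetP[s /setIdP[_ sK] ->].
apply/subsetP => P PK; have /is_pointP[s sU PE] := ptK P PK.
by rewrite PE; apply/imset_f/setIdP; rewrite -PE.
Qed.

Let V_line u : u \in nonnil S -> (#|[set s in V | lam (s * u)%R == 0%R]| <= n * D)%N.
Proof.
move=> uU; rewrite card_points.
- rewrite leq_mul2r; apply/orP; right.
  have /andP[_ /forallP/(_ (kerline u))] := arcK.
  rewrite kerline_is_line //=; apply: leq_trans; apply/subset_leq_card/subsetP.
  move=> _ /imsetP[s /setIdP[/setIdP[_ sK] su] ->].
  by apply/setIdP; rewrite pt_sub_kerline.
- by apply: subset_trans V_nonnil; apply/subsetP => s /setIdP[].
- by move=> k s kU /setIdP[sV su]; apply/setIdP; rewrite -mulrA lam_unitM // V_unitM.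
Qed.

Let class t := [set s in V | neighbour s t].

(* Double counting of the pairs (line through s0, point of K on it); a line
   through s0 is a class of units u with lam (u * s0) = 0. *)
Let class_count s0 : s0 \in V ->
  (D * (q ^ 4 - q ^ 2) + (#|class s0| - D) * (q ^ 3 - q ^ 2) + (#|V| - #|class s0|) * D
   <= (q ^ 4 - q ^ 2) * (n * D))%N /\ (D <= #|class s0| <= #|V|)%N.
Proof.
move=> s0V; have s0U := subsetP V_nonnil _ s0V.
have [v sv] := unit_nonnil chS s0U.
pose B := [set emb k * s0 | k in nonnil R].
have cardB : #|B| = D.
  rewrite card_imset ?(card_nonnil chR cardR) // => k l.
  by rewrite ![_ * s0]mulrC => /(unit_cancel chS s0U); exact: emb_inj.
have sBC : B \subset class s0.
  apply/subsetP => _ /imsetP[k kU ->]; apply/setIdP; rewrite V_unitM //; split=> //.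
  by apply/existsP; exists k.
have sCV : class s0 \subset V by apply/subsetP => s /setIdP[].
have Bv s : s \in V -> (s \in B) = in_base (s * v).
  move=> sV; apply/imsetP/in_baseP => [[k _ ->]|[k h]].
    by exists k; rewrite -mulrA sv mulr1.
  have sE : s = emb k * s0 by rewrite -h -mulrA [v * s0]mulrC sv mulr1.
  exists k => //; have := subsetP V_nonnil _ sV.
  by rewrite sE nonnilM // emb_nonnil => /andP[].
split; last by rewrite -cardB !subset_leq_card.
(* The elements of V split into the generators of the point of s0, its other neighbours, and the
   rest; these are joined to s0 by q^2 + q, q and 1 lines. *)
have -> : (D * (q ^ 4 - q ^ 2) + (#|class s0| - D) * (q ^ 3 - q ^ 2) +
    (#|V| - #|class s0|) * D =
    \sum_(s in V) #|[set u in nonnil S | (lam (u * s0)%R == 0%R) && (lam (u * s)%R == 0%R)]|)%N.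
  rewrite (big_setID (class s0)) (setIidPr sCV) /=.
  rewrite [in X in (_ = X + _)%N](big_setID B) (setIidPr sBC) /=.
  rewrite (eq_bigr (fun=> q ^ 4 - q ^ 2)%N); last first.
    move=> s sB; rewrite (card_common_zero _ s0U sv) -Bv ?sB //.
    exact: (subsetP sCV _ (subsetP sBC _ sB)).
  rewrite sum_nat_const cardB (eq_bigr (fun=> q ^ 3 - q ^ 2)%N); last first.
    move=> s /setDP[sC sB]; have [sV ns] := setIdP sC.
    by rewrite (card_common_zero _ s0U sv) -Bv // (negPf sB) -(neighbourE _ sv) ns.
  rewrite sum_nat_const cardsDS // cardB (eq_bigr (fun=> D)); last first.
    move=> s /setDP[sV sC]; have ns : ~~ near_base (s * v).
      by apply: contra sC => h; apply/setIdP; rewrite (neighbourE _ sv).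
    rewrite (card_common_zero _ s0U sv) (negPf ns).
    by rewrite (contraNF (@in_base_near _) ns).
  by rewrite sum_nat_const cardsDS.
have -> : (\sum_(s in V) #|[set u in nonnil S | (lam (u * s0)%R == 0%R) && (lam (u * s)%R == 0%R)]|
  = \sum_(u in nonnil S | lam (u * s0)%R == 0%R) #|[set s in V | lam (s * u)%R == 0%R]|)%N.
  under eq_bigr do rewrite card_setId_sum.
  under [RHS]eq_bigr do rewrite card_setId_sum.
  rewrite [RHS]exchange_big; apply: eq_bigr => s _; rewrite [RHS]big_mkcondr.
  by apply: eq_bigr => u _; rewrite [s * u]mulrC; case: (lam (u * s0) == 0).
apply: leq_trans (leq_sum _ (fun u (h : (u \in nonnil S) && (lam (u * s0) == 0)) =>
  V_line (proj1 (andP h)))) _.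
rewrite sum_nat_cond_const (card_translate (fun s => lam s == 0) s0U) card_zero_lam.
exact: leqnn.
Qed.

(** T represents every neighbour class by q - 1 elements, so counting neighbouring pairs from V and
    T sums the class sizes with weight q - 1. *)
Let class_bound m : (forall s, s \in V -> #|class s| <= m)%N ->
  (#|V| * (q - 1) <= (q ^ 3 - 1) * m)%N.
Proof.
move=> cm; have -> : (#|V| * (q - 1) = \sum_(s in V) #|[set t in T | neighbour s t]|)%N.
  rewrite -sum_nat_const; apply: eq_bigr => s sV.
  have sU := subsetP V_nonnil _ sV; have [v sv] := unit_nonnil chS sU.
  rewrite -(card_teich_near sv); apply: eq_card => t.
  apply/setIdP/setIdP => -[tT]; rewrite -(neighbourE _ sv) => h; split=> //.
    by apply: neighbour_sym h; case/teichP: tT.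
  exact: neighbour_sym h.
under eq_bigr do rewrite card_setId_sum.
rewrite exchange_big -(card_teich chS cardS e_gt0 QE) -sum_nat_const.
apply: leq_sum => t tT; rewrite -card_setId_sum -/(class t).
(* The assumed bound concerns classes of elements of V, and t need not be one; a nonempty class is
   recentred at one of its members. *)
case: (set_0Vmem (class t)) => [->|[s /setIdP[sV st]]]; first by rewrite cards0.
apply: leq_trans (cm s sV); apply/subset_leq_card/subsetP => s' /setIdP[s'V s't].
apply/setIdP; split=> //; apply: neighbour_trans s't _.
by apply: neighbour_sym st; apply: subsetP V_nonnil _ _.
Qed.

Lemma arc_bound : (2 * #|K| <= q ^ 4 - q)%N.
Proof.
have q1 := q_gt1.
have D0 : (0 < D)%N by rewrite subn_gt0 -{1}(expn1 q) ltn_exp2l.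
rewrite -(leq_pmul2r D0) -mulnA -cardV.
case: (boolP [exists s in V, q * (q - 1) * D <= 2 * #|class s|]%N).
  case/exists_inP=> s sV big; have [h1 h2] := class_count sV.
  exact: (arc_arith q1 erefl nE big h2 h1).
move=> small; pose m := ((q * (q - 1) * D) %/ 2)%N.
have := @class_bound m; rewrite expn3_sub1 => cb.
have {cb} h : (#|V| * (q - 1) <= (q ^ 2 + q + 1) * (q - 1) * m)%N.
  apply: cb => s sV; rewrite leq_divRL // mulnC ltnW // ltnNge.
  by apply: contra small => h; apply/exists_inP; exists s.
have mE : (m * 2 <= q * (q - 1) * D)%N by apply: leq_trunc_div.
have d0 : (0 < q - 1)%N by rewrite subn_gt0.
have {}h : (#|V| <= (q ^ 2 + q + 1) * m)%N.
  by rewrite -(leq_pmul2r d0) (leq_trans h) // mulnAC.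
have -> : (q ^ 4 - q = (q ^ 2 + q + 1) * (q * (q - 1)))%N.
  by case: (q) => // d; rewrite subSS subn0; lia.
rewrite -mulnA; apply: leq_trans (_ : _ <= (q ^ 2 + q + 1) * (m * 2))%N _.
  by rewrite mulnA mulnC leq_mul2r h orbT.
by rewrite leq_mul2l mE orbT.
Qed.

End ArcBound.

Lemma m_arc_half_sqr : m_arc R (q ^ 2 %/ 2) = ((q ^ 4 - q) %/ 2)%N.
Proof.
have cardK := card_oval_arc.
apply/eqP; rewrite eqn_leq; apply/andP; split.
  apply/bigmax_leqP => K arcK; rewrite leq_divRL // mulnC.
  exact: (arc_bound arcK half_sqr).
by rewrite -cardK mulKn //; apply: (bigmax_sup oval_arc) oval_arc_is_arc _.
Qed.

End Hyperoval.

(** * Galois rings *)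

Fact red2_is_zmod_morphism : zmod_morphism red2.
Proof.
by move=> [[|[|[|[|//]]]] hx] [[|[|[|[|//]]]] hy]; apply/val_inj.
Qed.
HB.instance Definition _ := GRing.isZmodMorphism.Build 'Z_4 'F_2 red2 red2_is_zmod_morphism.

Fact red2_is_monoid_morphism : monoid_morphism red2.
Proof.
by split=> [|[[|[|[|[|//]]]] hx] [[|[|[|[|//]]]] hy]]; apply/val_inj.
Qed.
HB.instance Definition _ := GRing.isMonoidMorphism.Build 'Z_4 'F_2 red2 red2_is_monoid_morphism.

Section RedPoly.
Notation red := (map_poly red2).
Implicit Types p : {poly 'Z_4}.

Lemma red_lift (s : {poly 'F_2}) : exists p, red p = s.
Proof.
exists (map_poly (fun z : 'F_2 => (nat_of_ord z)%:R) s); apply/polyP => i.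
rewrite coef_map coef_map_id0 //=.
by case: (s`_i) => -[|[|//]] ?; apply/val_inj.
Qed.

Lemma red_eq0 p : red p = 0 -> exists p', p = 2 * p'.
Proof.
move=> h; exists (map_poly (fun c : 'Z_4 => (c./2)%:R) p); apply/polyP => i.
rewrite mulr_natl coefMn coef_map_id0 //.
have := congr1 (fun s : {poly 'F_2} => s`_i) h; rewrite coef_map coef0 /=.
by case: (p`_i) => -[|[|[|[|//]]]] hi // _; apply/val_inj.
Qed.

Lemma double_red p : 2 * p = 0 -> red p = 0.
Proof.
move=> h; apply/polyP => i; rewrite coef_map coef0 /=.
have := congr1 (fun s : {poly 'Z_4} => s`_i) h; rewrite mulr_natl coefMn coef0.
by case: (p`_i) => -[|[|[|[|//]]]] hi // _; apply/val_inj.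
Qed.

Lemma red_double p : red (2 * p) = 0.
Proof.
rewrite rmorphM rmorph_nat [2%:R](_ : _ = 0) ?mul0r //.
by apply/eqP; rewrite -(rmorph_nat polyC) polyC_eq0.
Qed.

Lemma poly_Z4_four : 4%:R = 0 :> {poly 'Z_4}.
Proof. by apply/eqP; rewrite -(rmorph_nat polyC) polyC_eq0. Qed.

End RedPoly.

Lemma galois_chain2 (R : finComNzRingType) r : is_galois_ring R r -> chain2 R.
Proof.
case=> h [hm hs hirr [f [fsurj fker]]].
have fh g : f (g * h) = 0 by apply/fker; exists g.
have four : 4%:R = 0 :> R by rewrite -(rmorph_nat f) poly_Z4_four rmorph0.
have h0 : map_poly red2 h != 0.
  by case: hirr => + _; rewrite -size_poly_gt0; apply: ltn_trans.
split=> // a; have [p <-] := fsurj a.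
  (* From 2 p = g h, the reduction of g times that of h vanishes, and the latter is nonzero in a
     domain. So g = 2 g' and 2 (p - g' h) = 0. *)
  rewrite -(rmorph_nat f 2) -rmorphM => /fker[g hg].
  have := red_double p; rewrite hg rmorphM => /eqP.
  rewrite mulf_eq0 (negPf h0) orbF => /eqP/red_eq0[g' gE].
  have /double_red/red_eq0[p' pE] : 2 * (p - g' * h) = 0.
    by rewrite mulrBr hg gE; ring.
  exists (f p'); have -> : p = g' * h + 2 * p' by rewrite -pE; ring.
  by rewrite rmorphD fh add0r rmorphM rmorph_nat.
move=> fp; have cop : coprimep (map_poly red2 p) (map_poly red2 h).
  rewrite coprimep_sym irreducible_poly_coprime //; apply/negP => /dvdpP[k kE].
  have [k' k'E] := red_lift k.
  have /red_eq0[w wE] : map_poly red2 (p - k' * h) = 0.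
    by rewrite rmorphB rmorphM /= k'E kE subrr.
  apply: fp; have -> : p = k' * h + 2 * w by rewrite -wE; ring.
  by rewrite rmorphD fh add0r rmorphM rmorph_nat mulrA -natrM four mul0r.
have /Bezout_eq1_coprimepP[[u v] /= uv] := cop.
have [u' uE] := red_lift u; have [v' vE] := red_lift v.
have /red_eq0[w wE] : map_poly red2 (u' * p + v' * h - 1) = 0.
  by rewrite rmorphB rmorphD !rmorphM rmorph1 /= uE vE uv subrr.
have fE : f p * f u' = 1 + 2 * f w.
  have <- : f (u' * p + v' * h) = f p * f u' by rewrite rmorphD fh addr0 rmorphM mulrC.
  have -> : u' * p + v' * h = 1 + 2 * w by rewrite -wE; ring.
  by rewrite rmorphD rmorph1 rmorphM rmorph_nat.
(* The Bezout relation lifts only up to a factor 1 + 2 w, which is its own inverse in characteristic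
   4. *)
exists (f u' * (1 + 2 * f w)); rewrite mulrA fE.
have -> : (1 + 2 * f w) * (1 + 2 * f w) = 1 + 4%:R * (f w + f w ^+ 2) by ring.
by rewrite four mul0r addr0.
Qed.

(** Division by the monic h gives each class exactly one representative of degree below r, with r
    free coefficients in Z_4. *)
Lemma card_galois (R : finComNzRingType) r : is_galois_ring R r ->
  #|R| = ((2 ^ r) ^ 2)%N.
Proof.
case=> h [hm hs hirr [f [fsurj fker]]].
have <- : #|{: 'rV['Z_4]_r}| = ((2 ^ r) ^ 2)%N.
  by rewrite card_mx mul1n card_ord -expnM mulnC expnM.
pose g (v : 'rV['Z_4]_r) := f (rVpoly v).
have ginj : injective g.
  move=> v w /eqP; rewrite -subr_eq0 -rmorphB -raddfB /= => /eqP/fker[k kE].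
  apply/eqP; rewrite -subr_eq0; apply/eqP; rewrite -[v - w]rVpolyK kE.
  have small : (size (k * h)%R < size h)%N by rewrite -kE hs ltnS; apply: size_poly.
  by rewrite -(Pdiv.Ring.rmodp_small small) Pdiv.RingMonic.rmodp_mull // linear0.
rewrite -(card_codom ginj); apply: eq_card => y; rewrite inE; apply/esym/codomP.
have [p <-] := fsurj y; exists (poly_rV (Pdiv.Ring.rmodp p h)).
rewrite /g poly_rV_K; last first.
  by rewrite -ltnS -hs Pdiv.Ring.ltn_rmodpN0 // monic_neq0.
rewrite {1}(Pdiv.RingMonic.rdivp_eq hm p) rmorphD.
by have -> : f (Pdiv.Ring.rdivp p h * h) = 0; [apply/fker; eexists | rewrite add0r].
Qed.

Local Close Scope ring_scope.

Theorem theorem3p11 (R : finComNzRingType) (r : nat) :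
  (1 <= r)%N -> is_galois_ring R r ->
  let q := (2 ^ r)%N in
  (exists K : {set {set 'rV[R]_3}},
      is_arc K (q ^ 2 %/ 2) /\ #|K| = ((q ^ 4 - q) %/ 2)%N /\
      (forall L, is_line L -> meet K L = 0%N \/ meet K L = (q ^ 2 %/ 2)%N)) /\
  m_arc R (q ^ 2 %/ 2) = ((q ^ 4 - q) %/ 2)%N.
Proof.
move=> r_gt0 galR q.
have chR := galois_chain2 galR; have cardR : #|R| = (q ^ 2)%N := card_galois galR.
have [a [b [c rootless]]] := rootless_cubic chR cardR.
split; last exact: (m_arc_half_sqr chR cardR rootless r_gt0 erefl).
exists (oval_arc a b c q); split; first exact: (oval_arc_is_arc chR cardR rootless r_gt0 erefl).
split=> [|L /(is_lineP chR cardR rootless r_gt0 erefl)[u uU ->]]; last first.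
  exact: (meet_oval_arc chR cardR rootless r_gt0 erefl uU).
by rewrite -(card_oval_arc chR cardR rootless r_gt0 erefl) mulKn.
Qed.
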